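(* Let $(X,\mu)$ be a standard probability space, $f:X\to X$ an ergodic invertible measure-preserving transformation, and $(M,\tau)$ a von Neumann algebra with a finite faithful normal trace. Let $c:\mathbb{Z}\times X\to M^\times\cap\mathrm{GL}^2(M,\tau)$ satisfy $c(n+m,x)=c(n,f^mx)c(m,x)$ for all $n,m\in\mathbb{Z}$ and a.e. $x$, be measurable for the Strong Operator Topology on $M^\times$, and satisfy $\int_X\|\log(|c(1,x)|)\|_2\,d\mu(x)<\infty$. For a.e. $x$ let $\Lambda(x)$ be the limit operator, i.e. the positive element of $\mathrm{GL}^2(M,\tau)$ such that $\log\Lambda(x)=\lim_{n\to\infty}n^{-1}\log|c(n,x)|$ in $L^2(M,\tau)$. Then for a.e. $x\in X$, $$\lim_{n\to\infty}\big(\Delta|c(n,x)|\big)^{1/n}=\Delta\Lambda(x),$$ where $\Delta$ denotes the Fuglede–Kadison determinant.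
   Context: $\mathcal{H}$ is a separable Hilbert space and $M\subset B(\mathcal{H})$ is a von Neumann algebra; $M^\times$ is the group of $x\in M$ with bounded inverse $x^{-1}\in M$. The Strong Operator Topology is taken with respect to either $M\subset B(\mathcal{H})$ or $M\subset B(L^2(M,\tau))$. $L^2(M,\tau)$ is the Hilbert space completion of $M$ for $\langle x,y\rangle=\tau(x^*y)$ (here $\tau(I)<\infty$); $M$ acts on it by left multiplication. $L^0(M,\tau)$ is the $*$-algebra of closed densely defined operators on $L^2(M,\tau)$ affiliated with $M$ (commuting with every unitary of the commutant $M'\subset B(L^2(M,\tau))$; since $\tau$ is finite all of these are $\tau$-measurable); sums and products are the closures of the algebraic ones. For $x\in L^0(M,\tau)$, $|x|=(x^*x)^{1/2}$, $\mu_{|x|}(E)=\tau(1_E(|x|))$, and $\|x\|_2=(\int t^2\,d\mu_{|x|}(t))^{1/2}$; $L^2(M,\tau)$ is identified with $\{x\in L^0(M,\tau):\|x\|_2<\infty\}$. $\mathrm{GL}^2(M,\tau)=\{a\in L^0(M,\tau)^\times:\log|a|\in L^2(M,\tau)\}$, where $L^0(M,\tau)^\times$ is the group of invertible elements. The Fuglede–Kadison determinant of $a\in\mathrm{GL}^2(M,\tau)$ is $\Delta(a)=\exp\left(\int_0^\infty\log\lambda\,d\mu_{|a|}(\lambda)\right)$. The $L^2$-limit defining $\log\Lambda(x)$ exists for a.e. $x$ under the stated hypotheses: the drift $D=\lim_n n^{-1}\|\log(c(n,x)^*c(n,x))\|_2$ exists and is a.e. constant; for $D>0$ the existence of $\Lambda(x)$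 is the multiplicative ergodic theorem of the paper, and for $D=0$ the limit is $0$, so $\Lambda(x)=I$. *)

(* Defs.v *)
From HB Require Import structures.
From mathcomp Require Import all_boot all_order all_algebra.
From mathcomp Require Import sesquilinear complex.
From mathcomp Require Import all_classical all_reals all_analysis.

Set Implicit Arguments.
Unset Strict Implicit.
Unset Printing Implicit Defensive.

Import Order.TTheory GRing.Theory Num.Theory.
Import numFieldNormedType.Exports.

Local Open Scope classical_set_scope.
Local Open Scope ring_scope.
Local Open Scope complex_scope.

(* The inner product is the library's [{dot _ for conjC}], which is linear in
   its first argument: [hdot u v] stands for <v, u> when <x, y> = tau(x^* y). *)
Record hilbert (R : realType) := Hilbert {
  hsort :> completeNormedModType R[i] ;
  hdot : {dot hsort for (@Num.conj R[i])} ;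
  hdot_norm : forall u : hsort, hdot u u = `|u| ^+ 2
}.

Arguments hdot {R h}.

Section operators.
Variables (R : realType) (H : hilbert R).
Implicit Types (S T : H -> H) (M : set (H -> H)).

Definition separable_space := exists2 A : set H, countable A & dense A.

Definition bounded_op T := linear T /\ continuous T.

Definition adjoint_pair T S := forall u v : H, hdot (T u) v = hdot u (S v).

Definition unitary_op T :=
  [/\ linear T, (forall u, `|T u| = `|u|) & (forall v, exists u, T u = v)].

Definition op_ge0 T := forall u : H, 0 <= hdot (T u) u.

Definition op_le S T := forall u : H, hdot (S u) u <= hdot (T u) u.

(* The neighbourhoods of the weak operator topology are written out. *)
Definition wot_closed M := forall T, bounded_op T ->
  (forall (s : seq (H * H)) (e : R[i]), 0 < e -> exists2 S, M S &
     forall p, p \in s -> `|hdot (T p.1) p.2 - hdot (S p.1) p.2| < e) ->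
  M T.

Definition von_neumann_algebra M :=
  M `<=` bounded_op /\ M idfun /\
  (forall (k : R[i]) S T, M S -> M T -> M (fun u => k *: S u + T u)) /\
  (forall S T, M S -> M T -> M (S \o T)) /\
  (forall S, M S -> exists2 T, M T & adjoint_pair S T) /\
  wot_closed M.

Definition self_adjoint_in M S := M S /\ adjoint_pair S S.

(* T is the supremum in M of an upward directed set of positive elements. *)
Definition directed_sup M (D : set (H -> H)) T :=
  [/\ D !=set0 /\ (forall S, D S -> M S /\ op_ge0 S),
      (forall S1 S2, D S1 -> D S2 ->
         exists S3, [/\ D S3, op_le S1 S3 & op_le S2 S3]),
      self_adjoint_in M T /\ (forall S, D S -> op_le S T) &
      forall T', self_adjoint_in M T' -> (forall S, D S -> op_le S T') ->
        op_le T T'].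

(* A positive scalar-valued functional on all of M is a finite trace; its
   values outside M are irrelevant. *)
Definition finite_faithful_normal_trace M (tau : (H -> H) -> R[i]) :=
  (forall (k : R[i]) S T, M S -> M T ->
     tau (fun u => k *: S u + T u) = k * tau S + tau T) /\
  (forall S T, M S -> M T -> tau (S \o T) = tau (T \o S)) /\
  (forall S, M S -> op_ge0 S -> 0 <= tau S) /\
  (forall S, M S -> op_ge0 S -> tau S = 0 -> S = cst 0) /\
  (forall D T, directed_sup M D T ->
     complex.Re (tau T) = sup [set complex.Re (tau S) | S in D]).

(* M^x *)
Definition invertible_in M S :=
  M S /\ exists T, [/\ M T, S \o T = idfun & T \o S = idfun].

End operators.

Record tracial_algebra (R : realType) := TracialAlgebra {
  tspace : hilbert R ;
  tspace_separable : separable_space tspace ;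
  talg : set (tspace -> tspace) ;
  talg_vn : von_neumann_algebra talg ;
  trace : (tspace -> tspace) -> R[i] ;
  traceP : finite_faithful_normal_trace talg trace
}.

Notation op N := (tspace N -> tspace N).

(* L^2(M,tau): a Hilbert space in which M, with <x,y> = tau(x^* y), embeds
   isometrically and densely, together with the action [lmul] of M extending
   left multiplication. These data are unique up to unitary isomorphism. *)
Record L2_space (R : realType) (N : tracial_algebra R) := L2Space {
  L2 : hilbert R ;
  L2_of : op N -> L2 ;
  lmul : op N -> L2 -> L2 ;
  L2_of_linear : forall (k : R[i]) (x y : op N), talg x -> talg y ->
    L2_of (fun u => k *: x u + y u) = k *: L2_of x + L2_of y ;
  L2_of_dot : forall x y z : op N, talg x -> talg y -> talg z ->
    adjoint_pair x z -> hdot (L2_of y) (L2_of x) = trace (z \o y) ;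
  L2_of_dense : dense (@L2_of @` @talg R N) ;
  lmul_bounded : forall x : op N, talg x -> bounded_op (lmul x) ;
  lmul_L2_of : forall x y : op N, talg x -> talg y ->
    lmul x (L2_of y) = L2_of (x \o y)
}.

Arguments L2 {R N}.
Arguments L2_of {R N}.
Arguments lmul {R N}.

(* Unbounded operators on L^2(M,tau) are represented by their graphs. *)
Section unbounded.
Variables (R : realType) (N : tracial_algebra R) (K : L2_space N).

Local Notation graph := (set (L2 K * L2 K)).
Implicit Types (a b S T : graph) (E : set (measurableTypeR R) -> op N).

Definition linear_op a :=
  [/\ a (0, 0),
      (forall (k : R[i]) p q, a p -> a q ->
         a (k *: p.1 + q.1, k *: p.2 + q.2)) &
      forall v, a (0, v) -> v = 0].

Definition dom a : set (L2 K) := [set u | exists v, a (u, v)].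

Definition commutant : set (L2 K -> L2 K) := [set T | bounded_op T /\
  forall x : op N, talg x -> T \o lmul K x = lmul K x \o T].

(* L^0(M,tau) *)
Definition affiliated a :=
  [/\ linear_op a, closed a, dense (dom a) &
      forall U, commutant U -> unitary_op U ->
        forall p, a p -> a (U p.1, U p.2)].

Definition op_graph (x : op N) : graph := [set p | p.2 = lmul K x p.1].

(* product in L^0(M,tau): closure of the composition *)
Definition mulop a b : graph :=
  closure [set p | exists w, b (p.1, w) /\ a (w, p.2)].

Definition adjop a : graph :=
  [set p | forall q, a q -> hdot q.2 p.1 = hdot q.1 p.2].

Definition invertible_op a := affiliated a /\
  exists b, [/\ affiliated b, mulop a b = op_graph idfun &
                mulop b a = op_graph idfun].

Definition positive_op a :=
  [/\ linear_op a, adjop a = a & forall p, a p -> 0 <= hdot p.2 p.1].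

(* |a| = (a^* a)^(1/2) *)
Definition absop a : graph :=
  xget set0 [set p | positive_op p /\ mulop p p = mulop (adjop a) a].

Definition spectral_form E (u : L2 K) (B : set (measurableTypeR R)) : \bar R :=
  (complex.Re (hdot (lmul K (E B) u) u))%:E.

(* The spectral projections of an affiliated self-adjoint operator belong
   to M, so projection-valued measures take their values in M. *)
Definition projection_measure E :=
  [/\ (forall B, measurable B -> talg (E B) /\ adjoint_pair (E B) (E B)),
      (forall B C, measurable B -> measurable C ->
         E (B `&` C) = E B \o E C),
      E setT = idfun &
      forall u, semi_sigma_additive (spectral_form E u)].

(* T = \int f dE, given by its domain and its quadratic form. *)
Definition is_spectral_integral E (f : R -> R) T :=
  [/\ linear_op T,
      (forall u, dom T u <->
         (\int[spectral_form E u]_t ((f t) ^+ 2)%:E < +oo)%E) &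
      forall u v, T (u, v) ->
        hdot v u = (fine (\int[spectral_form E u]_t (f t)%:E)%E)%:C].

Definition spectral_measure E T :=
  projection_measure E /\ is_spectral_integral E idfun T.

(* Borel functional calculus f(T); the junk value set0 is not in L^0. *)
Definition fun_calc (f : R -> R) T : graph :=
  xget set0 [set S | exists E,
    spectral_measure E T /\ is_spectral_integral E f S].

(* [ln] vanishes on the nonpositive reals; this is harmless, as logop is only
   applied to positive injective operators, for which ]-oo, 0] is null. *)
Definition logop T := fun_calc (@ln R) T.

(* mu_|a|(B) = tau(1_B(|a|)); the junk value +oo makes norm2 infinite. *)
Definition mu_abs a : set (measurableTypeR R) -> \bar R :=
  xget (fun=> +oo%E) [set m | exists E, spectral_measure E (absop a) /\
    m = fun B => (complex.Re (trace (E B)))%:E].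

Definition norm2 a : \bar R := ((\int[mu_abs a]_t (t ^+ 2)%:E) `^ 2^-1)%E.

Definition in_L2 a := affiliated a /\ (norm2 a < +oo)%E.

(* The identification of {a in L^0 | ||a||_2 < oo} with the completion L^2
   sends a to a applied to the unit of M. *)
Definition L2_vector a : L2 K := xget 0 [set v | a (L2_of K idfun, v)].

Definition in_GL2 a := invertible_op a /\ in_L2 (logop (absop a)).

(* Fuglede-Kadison determinant *)
Definition fk_det a : R :=
  expR (fine (\int[mu_abs a]_(t in `]0%R, +oo[) (ln t)%:E)%E).

End unbounded.

Arguments op_graph {R N} K x.

Definition standard_borel (R : realType) d (X : measurableType d) :=
  exists (P : completePseudoMetricType R) (phi : X -> P),
    [/\ hausdorff_space P, @second_countable P, bijective phi &
        forall A : set X, measurable A <->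
          exists2 B : set P, <<s @open P >> B & A = phi @^-1` B].

Definition measure_preserving (R : realType) d (X : measurableType d)
    (mu : probability X R) (f : X -> X) :=
  measurable_fun setT f /\ forall A, measurable A -> mu (f @^-1` A) = mu A.

Definition ergodic (R : realType) d (X : measurableType d)
    (mu : probability X R) (f : X -> X) :=
  forall A, measurable A -> f @^-1` A = A -> mu A = 0%E \/ mu A = 1%E.

(* f^m for m in Z, where g is the inverse of f *)
Definition iterz (X : Type) (f g : X -> X) (m : int) : X -> X :=
  match m with Posz n => iter n f | Negz n => iter n.+1 g end.

(* [{ptws H -> H}] induces the strong operator topology on B(H). *)
Definition sot_measurable (R : realType) d (X : measurableType d)
    (H : hilbert R) (c : X -> H -> H) :=
  forall U : set {ptws H -> H}, open U -> measurable (c @^-1` U).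

(* Main.v *)
(* Let xi be the unit of M in L^2. For positive A with log A in L^2 one has
   log Delta(A) = <log A xi, xi>, because mu_|A| is the measure <E xi, xi> of the
   spectral measure E of A. Hence n^-1 log Delta(|c(n,x)|) is the inner product of
   n^-1 log|c(n,x)| with xi, and the L^2 convergence to log Lambda(x), which is a
   hypothesis, passes to the limit; no ergodic theorem is needed.

   The work is to show that the objects picked by choice in the definitions are the
   expected ones. The spectral measure of a positive A is unique because the range
   of E(]-oo, l]) consists of the vectors u with |A^k u| = O(l^k). A positive S with
   S^2 = A^2 preserves these ranges, hence commutes with E and with A on them; there
   y = (S - A) u satisfies (S + A) y = 0, so y = 0 and S = A. *)

Require Import Defs.
From HB Require Import structures.
From mathcomp Require Import all_boot all_order all_algebra.
From mathcomp Require Import sesquilinear complex.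
From mathcomp Require Import all_classical all_reals all_analysis.
From mathcomp Require Import measurable_realfun ring lra.

Set Implicit Arguments.
Unset Strict Implicit.
Unset Printing Implicit Defensive.

Import Order.TTheory GRing.Theory Num.Theory.
Import numFieldNormedType.Exports.

Local Open Scope classical_set_scope.
Local Open Scope ring_scope.
Local Open Scope complex_scope.

(** * The real inner product *)

(** A spectral integral is given by its domain and its quadratic form alone. That it commutes with
    its projections, is self-adjoint and obeys bounds on spectral subspaces is recovered from the
    form by polarization and the Cauchy-Schwarz inequality.

    No spectral theorem is proved. The spectral measures of |c(n,x)| and of Lambda(x) are read off
    from the membership of their logarithms in L^2, as the default value of the functional calculus
    is not affiliated; any other spectral measure is an image of one of these.

    The determinant of A is defined through |A|, so even a positive A calls for |A| = A, that is,
    for a unique square root. Moreover log A is not positive and its 2-norm speaks of |log A|: an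
    absolute value of log A with a known spectral measure is exhibited, and then a finite 2-norm
    says that xi lies in the domain of log A.

    The growth criterion for spectral subspaces is phrased with A^2, because a root S is tied to A
    only by S^2 = A^2. *)

Section real_inner_product.
Variables (R : realType) (H : hilbert R).
Implicit Types (u v w : H) (r : R) (z : R[i]).

(** Taking real parts puts all estimates in R, within reach of [lra] and [nra]; [hdotE] recovers the
    complex product. *)
Definition ip u v : R := complex.Re (hdot u v).

Definition nsq u : R := ip u u.

Lemma hdotC u v : hdot u v = (hdot v u)^*%C.
Proof. by rewrite hermC expr0 mul1r. Qed.

Lemma hdotZl z u v : hdot (z *: u) v = z * hdot u v.
Proof. by rewrite linearZl_LR. Qed.

Lemma hdotZr z u v : hdot u (z *: v) = z^*%C * hdot u v.
Proof. by rewrite linearZr_LR. Qed.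

Lemma ipC u v : ip u v = ip v u.
Proof. by rewrite /ip hdotC; case: (hdot v u). Qed.

Lemma ipDl u v w : ip (u + v) w = ip u w + ip v w.
Proof. by rewrite /ip linearDl raddfD. Qed.

Lemma ipNl u w : ip (- u) w = - ip u w.
Proof. by rewrite /ip linearNl raddfN. Qed.

Lemma ipBl u v w : ip (u - v) w = ip u w - ip v w.
Proof. by rewrite ipDl ipNl. Qed.

Lemma ip0l u : ip 0 u = 0.
Proof. by rewrite /ip linear0l. Qed.

Lemma ipZl r u w : ip (r%:C *: u) w = r * ip u w.
Proof. by rewrite /ip hdotZl; case: (hdot u w) => a b /=; rewrite mul0r subr0. Qed.

Lemma ipDr u v w : ip w (u + v) = ip w u + ip w v.
Proof. by rewrite !(ipC w) ipDl. Qed.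

Lemma ipNr u w : ip w (- u) = - ip w u.
Proof. by rewrite !(ipC w) ipNl. Qed.

Lemma ipBr u v w : ip w (u - v) = ip w u - ip w v.
Proof. by rewrite !(ipC w) ipBl. Qed.

Lemma ip0r u : ip u 0 = 0.
Proof. by rewrite ipC ip0l. Qed.

Lemma ipZr r u w : ip w (r%:C *: u) = r * ip w u.
Proof. by rewrite !(ipC w) ipZl. Qed.

Lemma ip_ir u v : ip u ('i *: v) = complex.Im (hdot u v).
Proof.
rewrite /ip hdotZr; case: (hdot u v) => a b /=.
by rewrite mul0r sub0r mulN1r opprK.
Qed.

Lemma ip_il u v : ip ('i *: u) v = - complex.Im (hdot u v).
Proof. by rewrite /ip hdotZl; case: (hdot u v) => a b /=; rewrite mul0r sub0r mul1r. Qed.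

Lemma ip_ii u v : ip ('i *: u) ('i *: v) = ip u v.
Proof.
rewrite ip_ir hdotZl /ip; case: (hdot u v) => a b /=.
by rewrite mul0r mul1r add0r.
Qed.

Lemma ip_iC u v : ip ('i *: u) v = - ip u ('i *: v).
Proof. by rewrite ip_il ip_ir. Qed.

Lemma hdotE u v : hdot u v = (ip u v) +i* (ip u ('i *: v)).
Proof. by rewrite ip_ir /ip; case: (hdot u v). Qed.

Definition ipE := (ipDl, ipDr, ipNl, ipNr, ipZl, ipZr).

Lemma hnorm_nsq u : `|u| ^+ 2 = (nsq u)%:C.
Proof.
rewrite -hdot_norm /nsq /ip; have : 0 <= hdot u u.
  by rewrite hdot_norm exprn_ge0.
by case: (hdot u u) => a b; rewrite lecE /= => /andP[/eqP -> _].
Qed.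

Lemma nsq_ge0 u : 0 <= nsq u.
Proof. by rewrite -ler0c -hnorm_nsq exprn_ge0. Qed.

Lemma nsq_eq0 u : nsq u = 0 -> u = 0.
Proof.
move=> u0; apply/eqP; rewrite -normr_eq0 -sqrf_eq0 hnorm_nsq u0.
exact/eqP.
Qed.

Lemma hnormE u : `|u| = (Num.sqrt (nsq u))%:C.
Proof.
apply/eqP; rewrite -(@eqrXn2 _ 2) //; last by rewrite ler0c sqrtr_ge0.
by rewrite hnorm_nsq -rmorphXn /= sqr_sqrtr ?nsq_ge0.
Qed.

Lemma nsq0 : nsq 0 = 0. Proof. exact: ip0l. Qed.

Lemma nsqN u : nsq (- u) = nsq u.
Proof. by rewrite /nsq ipNl ipNr opprK. Qed.

Lemma nsqD u v : nsq (u + v) = nsq u + nsq v + 2 * ip u v.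
Proof. by rewrite /nsq !ipE (ipC v u); ring. Qed.

Lemma nsqB u v : nsq (u - v) = nsq u + nsq v - 2 * ip u v.
Proof. by rewrite nsqD nsqN ipNr mulrN. Qed.

Lemma nsq_distC u v : nsq (u - v) = nsq (v - u).
Proof. by rewrite -nsqN opprB. Qed.

Lemma nsqD_le u v : nsq (u + v) <= 2 * nsq u + 2 * nsq v.
Proof. by have := nsq_ge0 (u - v); rewrite nsqB nsqD; lra. Qed.

Lemma nsq_dist_le u v w : nsq (u - w) <= 2 * nsq (u - v) + 2 * nsq (v - w).
Proof.
by rewrite -[X in nsq (X - w)](subrK v) -addrA nsqD_le.
Qed.

Lemma quadratic_discriminant (a b e : R) : 0 <= a -> 0 <= e ->
  (forall t, 0 <= a + 2 * t * b + t ^+ 2 * e) -> b ^+ 2 <= a * e.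
Proof.
move=> a0; rewrite le_eqVlt => /predU1P[<-|e0] abe.
  rewrite mulr0; have [->|b0] := eqVneq b 0; first by rewrite expr0n.
  (* For e = 0 and b != 0 the affine function takes the value -1 at this t. *)
  have := abe (- (a + 1) / (2 * b)).
  have -> : a + 2 * (- (a + 1) / (2 * b)) * b + (- (a + 1) / (2 * b)) ^+ 2 * 0 = - 1.
    by field.
  by rewrite oppr_ge0 ler10.
(* The minimum of the quadratic is attained at t = - b / e. *)
have := abe (- b / e).
rewrite -(ler_pM2r e0) mul0r.
have -> : (a + 2 * (- b / e) * b + (- b / e) ^+ 2 * e) * e = a * e - b ^+ 2.
  by field; rewrite gt_eqF.
by rewrite subr_ge0.
Qed.

Lemma cauchy_schwarz u v : ip u v ^+ 2 <= nsq u * nsq v.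
Proof.
apply: quadratic_discriminant; rewrite ?nsq_ge0// => t.
have := nsq_ge0 (u + t%:C *: v).
by rewrite nsqD {2}/nsq !ipE mulrA -expr2 -/(nsq v) addrAC mulrA.
Qed.

Lemma nbhs_nsqP u (A : set H) :
  nbhs u A <-> exists2 e : R, 0 < e & forall v, nsq (v - u) < e -> A v.
Proof.
split => [/nbhs_ballP[e /= e0 eA]|[e e0 eA]].
  have eE : e = (complex.Re e)%:C.
    by apply/esym/RRe_real; exact: gtr0_real.
  have re0 : 0 < complex.Re e by rewrite -ltcR -eE.
  exists (complex.Re e ^+ 2) => [|v vu]; first exact: exprn_gt0.
  apply: eA; rewrite -ball_normE /ball_ /= hnormE eE ltcR nsq_distC.
  by rewrite -[ltRHS]ger0_norm ?ltW// -sqrtr_sqr ltr_sqrt ?exprn_gt0.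
apply/nbhs_ballP; exists (Num.sqrt e)%:C => /=; first by rewrite ltcR sqrtr_gt0.
move=> v; rewrite -ball_normE /ball_ /= hnormE ltcR ltr_sqrt// => uv.
by apply: eA; rewrite nsq_distC.
Qed.

Lemma closure_nsqP (A : set (H * H)) p :
  closure A p <-> forall e : R, 0 < e ->
    exists q, [/\ A q, nsq (q.1 - p.1) < e & nsq (q.2 - p.2) < e].
Proof.
split=> [Ap e e0|Ap B].
  have [] := Ap ([set v | nsq (v - p.1) < e] `*` [set v | nsq (v - p.2) < e]).
    exists ([set v | nsq (v - p.1) < e], [set v | nsq (v - p.2) < e]) => //.
    by split; apply/nbhs_nsqP; exists e.
  by move=> q [Aq [? ?]]; exists q.
move=> [[B1 B2] /= [/nbhs_nsqP[e1 e10 e1B] /nbhs_nsqP[e2 e20 e2B]]] sub.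
have [|q [Aq q1 q2]] := Ap (Num.min e1 e2); first by rewrite lt_min e10.
exists q; split=> //; apply: sub; split => /=.
- by apply: e1B; move: q1; rewrite lt_min => /andP[].
- by apply: e2B; move: q2; rewrite lt_min => /andP[].
Qed.

Lemma dense_nsqP (A : set H) :
  dense A <-> forall u (e : R), 0 < e -> exists2 v, A v & nsq (v - u) < e.
Proof.
split=> [Ad u e e0|Ad U [u Uu] Uo].
  have Eo : open (interior [set v | nsq (v - u) < e]) by exact: open_interior.
  have [|v [/interior_subset vu Av]] := Ad _ _ Eo.
    by exists u; apply/nbhs_nsqP; exists e.
  by exists v.
have /nbhs_nsqP[e e0 eU] : nbhs u U by apply: open_nbhs_nbhs.
by have [v Av vu] := Ad u _ e0; exists v; split => //; apply: eU.
Qed.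

Lemma orthogonal_dense_eq0 (A : set H) u : dense A ->
  (forall v, A v -> ip u v = 0) -> u = 0.
Proof.
move=> /dense_nsqP Ad uA; apply: nsq_eq0; apply/eqP; rewrite eq_le nsq_ge0 andbT.
apply/ler_addgt0Pr => e e0; rewrite add0r.
have [v /uA uv vu] := Ad u _ e0.
apply/ltW/(le_lt_trans _ vu); rewrite nsqB (ipC v) uv mulr0 subr0.
by rewrite lerDr nsq_ge0.
Qed.

Lemma cvg_nsqP (u_ : nat -> H) u : u_ @ \oo --> u <->
  forall e : R, 0 < e -> \forall n \near \oo, nsq (u_ n - u) < e.
Proof.
split=> [uu e e0|uu A /nbhs_nsqP[e e0 eA]].
  by apply: (uu [set v | nsq (v - u) < e]); apply/nbhs_nsqP; exists e.
by apply: filterS (uu _ e0) => n; exact: eA.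
Qed.

Lemma cauchy_nsq_cvg (u_ : nat -> H) :
  (forall e : R, 0 < e -> exists n, forall i j, (n <= i)%N -> (n <= j)%N ->
     nsq (u_ i - u_ j) < e) -> exists u, u_ @ \oo --> u.
Proof.
move=> uc; suff /cauchy_cvg : cauchy (u_ @ \oo).
  by move=> uu; exists (lim (u_ @ \oo)).
apply: cauchy_exP => e e0.
have eE : e = (complex.Re e)%:C by apply/esym/RRe_real; exact: gtr0_real.
have re0 : 0 < complex.Re e by rewrite -ltcR -eE.
have [|n un] := uc (complex.Re e ^+ 2); first exact: exprn_gt0.
exists (u_ n); exists n => // m /= nm.
rewrite -ball_normE /ball_ /= hnormE eE ltcR.
rewrite -[ltRHS]ger0_norm ?ltW// -sqrtr_sqr ltr_sqrt ?exprn_gt0//.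
exact: un.
Qed.

Lemma ip_cvg (u_ : nat -> H) u w : u_ @ \oo --> u ->
  (fun n => ip (u_ n) w) @ \oo --> ip u w.
Proof.
move=> /cvg_nsqP uu; apply/cvgrPdist_lt => e e0.
have w0 : 0 < nsq w + 1 by rewrite ltr_wpDl ?nsq_ge0.
have e20 : 0 < e ^+ 2 / (nsq w + 1) by rewrite divr_gt0 ?exprn_gt0.
near=> n.
rewrite -ipBl -ltr_sqr ?nnegrE ?normr_ge0 ?(ltW e0)// real_normK; last exact: num_real.
apply: (le_lt_trans (cauchy_schwarz _ _)).
rewrite nsq_distC; apply: (@le_lt_trans _ _ (nsq (u_ n - u) * (nsq w + 1))).
  by rewrite ler_wpM2l ?nsq_ge0 ?lerDl.
by rewrite -ltr_pdivlMr//; near: n; exact: uu.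
Unshelve. all: by end_near. Qed.

End real_inner_product.

Section eq_integral_set_function.
Import HBNNSimple.

(* [spectral_form] and [mu_abs] need not be measures off the measurable sets. *)
Lemma eq_integral_set_function d (T : measurableType d) (R : realType)
    (m1 m2 : set T -> \bar R) (f : T -> \bar R) :
  (forall A, measurable A -> m1 A = m2 A) ->
  forall D, (\int[m1]_(x in D) f x = \int[m2]_(x in D) f x)%E.
Proof.
move=> m12 D.
(* [sintegral] evaluates the set function only at level sets of simple functions, which are
   measurable. *)
have E (h : {nnsfun T >-> R}) : sintegral m1 h = sintegral m2 h.
  by apply: eq_fsbigr => r _; rewrite m12.
rewrite /integral; congr (ereal_sup _ - ereal_sup _)%E;
  by apply/seteqP; split => x [h hf <-]; exists h.
Qed.

End eq_integral_set_function.

(** * Projection-valued measures and their scalar measures *)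

Section projection_valued_measure.
Variables (R : realType) (H : hilbert R).
Implicit Types (u v w : H) (P : set (measurableTypeR R) -> H -> H).

(* For [P B := lmul K (E B)] this is what [projection_measure K E] provides. *)
Definition pvm P :=
  [/\ forall B, measurable B -> linear (P B),
      forall B u v, measurable B -> hdot (P B u) v = hdot u (P B v),
      forall B C u, measurable B -> measurable C ->
        P (B `&` C) u = P B (P C u),
      forall u, P setT u = u &
      forall u, semi_sigma_additive (fun B => (ip (P B u) u)%:E)].

Variable P : set (measurableTypeR R) -> H -> H.
Hypothesis PP : pvm P.
Implicit Types B C : set (measurableTypeR R).

Lemma pvmP B u v : measurable B -> forall z, P B (z *: u + v) = z *: P B u + P B v.
Proof. by case: PP => lin _ _ _ _ mB z; rewrite (lin B mB). Qed.

Lemma pvmD B u v : measurable B -> P B (u + v) = P B u + P B v.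
Proof. by move=> mB; rewrite -[u]scale1r pvmP// !scale1r. Qed.

Lemma pvm0 B : measurable B -> P B 0 = 0.
Proof. by move=> mB; apply: (@addrI _ (P B 0)); rewrite -pvmD// !addr0. Qed.

Lemma pvmZ B z u : measurable B -> P B (z *: u) = z *: P B u.
Proof. by move=> mB; rewrite -[z *: u]addr0 pvmP// pvm0// addr0. Qed.

Lemma pvmN B u : measurable B -> P B (- u) = - P B u.
Proof. by move=> mB; rewrite -scaleN1r pvmZ// scaleN1r. Qed.

Lemma pvmB B u v : measurable B -> P B (u - v) = P B u - P B v.
Proof. by move=> mB; rewrite pvmD// pvmN. Qed.

Lemma pvmI B C u : measurable B -> measurable C -> P (B `&` C) u = P B (P C u).
Proof. by case: PP => _ _ + _ _; exact. Qed.

Lemma pvmK B u : measurable B -> P B (P B u) = P B u.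
Proof. by move=> mB; rewrite -pvmI// setIid. Qed.

Lemma pvmT u : P setT u = u. Proof. by case: PP. Qed.

Lemma pvm_hdot B u v : measurable B -> hdot (P B u) v = hdot u (P B v).
Proof. by case: PP => _ + _ _ _; exact. Qed.

Lemma pvm_ip B u v : measurable B -> ip (P B u) v = ip u (P B v).
Proof. by move=> mB; rewrite /ip pvm_hdot. Qed.

Lemma pvm_nsq B u : measurable B -> nsq (P B u) = ip (P B u) u.
Proof. by move=> mB; rewrite /nsq -pvm_ip// pvmK. Qed.

(* The measure <P u, u>; the proof argument makes its measure instance inferable. *)
Definition specm of pvm P := fun u B => (nsq (P B u))%:E.

Local Notation nu := (specm PP).

Lemma specmE u B : measurable B -> nu u B = (ip (P B u) u)%:E.
Proof. by move=> mB; rewrite /specm pvm_nsq. Qed.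

Lemma pvm_set0 u : P set0 u = 0.
Proof.
apply: nsq_eq0; have m0 : measurable (set0 : set (measurableTypeR R)) by [].
have [_ _ _ _ /(_ u) sa] := PP.
have triv : trivIset setT (fun _ : nat => set0 : set (measurableTypeR R)).
  by apply/trivIsetP => i j _ _ _; rewrite set0I.
have := sa (fun=> set0) (fun=> m0) triv.
rewrite bigcup0// -pvm_nsq// => /(_ m0) u0.
(* With c = |P set0 u|^2, the partial sums over copies of the empty set are n c and converge to c;
   from n = 2 on they are at least 2 c. *)
have u2 : ((nsq (P set0 u) + nsq (P set0 u))%:E <= (nsq (P set0 u))%:E)%E.
  apply: cvge_ge u0; exists 2%N => // -[|[|n]]// _ /=.
  rewrite sumEFin lee_fin !big_nat_recr//= -addrA lerDr sumr_ge0// => i _.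
  exact: nsq_ge0.
apply/eqP; rewrite eq_le nsq_ge0 andbT.
by move: u2; rewrite lee_fin gerDl.
Qed.

Let nu0 u : nu u set0 = 0%E.
Proof. by rewrite /specm pvm_set0 nsq0. Qed.

(** A measure must be nonnegative at every set, measurable or not; hence [specm] is a squared norm
    and not [ip (P B u) u]. *)
Let nu_ge0 u B : (0 <= nu u B)%E.
Proof. by rewrite lee_fin nsq_ge0. Qed.

Let nu_sigma_additive u : semi_sigma_additive (nu u).
Proof.
have [_ _ _ _ /(_ u) sa] := PP => F mF tF mUF.
rewrite specmE//.
have -> : (fun n => (\sum_(0 <= i < n) nu u (F i))%E) =
  (fun n => (\sum_(0 <= i < n) (ip (P (F i) u) u)%:E)%E).
  by apply/funext => n; apply: eq_bigr => i _; rewrite specmE.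
exact: sa.
Qed.

HB.instance Definition _ u :=
  isMeasure.Build _ _ _ (nu u) (nu0 u) (nu_ge0 u) (@nu_sigma_additive u).

Let nu_fin u : fin_num_fun (nu u). Proof. by []. Qed.

HB.instance Definition _ u := Measure_isFinite.Build _ _ _ (nu u) (nu_fin u).

Lemma integral_specm u f D :
  (\int[fun B => (ip (P B u) u)%:E]_(t in D) f t = \int[nu u]_(t in D) f t)%E.
Proof.
by apply: eq_integral_set_function => A mA; rewrite specmE.
Qed.

Lemma specm_setC u B : measurable B -> nsq (P B u) + nsq (P (~` B) u) = nsq u.
Proof.
move=> mB; apply: EFin_inj; rewrite EFinD.
rewrite -[(nsq (P B u))%:E]/(nu u B) -[(nsq (P (~` B) u))%:E]/(nu u (~` B)).
rewrite -measureU//; last by rewrite setICr.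
  by rewrite setUCr -[in RHS](pvmT u).
exact: measurableC.
Qed.

(** Additivity is assumed for the quadratic form only; for vectors it results from expanding the
    squared norm of the difference of the two sides. *)
Lemma pvm_setC u B : measurable B -> P (~` B) u = u - P B u.
Proof.
move=> mB; apply/eqP; rewrite -subr_eq0; apply/eqP/nsq_eq0.
have mC := measurableC mB.
rewrite opprB addrA nsqB nsqD.
have := specm_setC u mB.
rewrite ipDl -!pvm_nsq//.
have -> : ip (P (~` B) u) (P B u) = 0.
  by rewrite pvm_ip// -pvmI// setICl pvm_set0 ip0r.
lra.
Qed.

Lemma specm_proj u B C : measurable B -> measurable C ->
  nu (P B u) C = nu u (B `&` C).
Proof. by move=> mB mC; rewrite /specm setIC pvmI. Qed.

Lemma specm_split u B C : measurable B -> measurable C ->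
  nu u C = (nu (P B u) C + nu (P (~` B) u) C)%E.
Proof.
move=> mB mC; have mCB := measurableC mB.
rewrite !specm_proj// -measureU//.
- by rewrite -setIUl setUCr setTI.
- exact: measurableI.
- exact: measurableI.
- by rewrite setIACA setICr set0I.
Qed.

End projection_valued_measure.

(** * Projection-valued measures and spectral integrals *)

Section nonneg_integral_bounds.
Import HBNNSimple.
Context d (T : measurableType d) (R : realType).
Local Open Scope ereal_scope.

(** A simple function below g has finitely many disjoint level sets, and the hypothesis bounds its
    integral on each by the [m2] mass of that set. *)
Lemma ge0_integral_le_measure (m1 m2 : {measure set T -> \bar R}) (g : T -> \bar R) :
  (forall t, 0 <= g t) ->
  (forall (x : R) B, (0 <= x)%R -> measurable B ->
     (forall t, B t -> x%:E <= g t) -> x%:E * m1 B <= m2 B) ->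
  \int[m1]_t g t <= m2 setT.
Proof.
move=> g0 m12; rewrite ge0_integralTE//; apply: ub_ereal_sup => _ [h hg <-].
have hfin : finite_set (range h) by [].
rewrite sintegralE; apply: (@le_trans _ _ (\sum_(x \in range h) m2 (h @^-1` [set x]))).
  apply: lee_fsum => // x [t _ <-]; apply: m12 => //.
  by move=> s /= hst; rewrite -hst; exact: hg.
rewrite -measure_fin_bigcup//; last first.
  by move=> i j _ _ [t [/= <- <-]].
by apply: le_measure; rewrite ?inE//; apply: fin_bigcup_measurable.
Qed.

(** Lower semicontinuity of the integral: a simple h <= g is bounded, so the small measure [m2]
    contributes little to its integral, while the part from [m1] is at most C. *)
Lemma ge0_integral_le_lsc (m : {measure set T -> \bar R}) (g : T -> \bar R)
    (C : R) :
  (forall t, 0 <= g t) -> measurable_fun setT g ->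
  (forall e, (0 < e)%R -> exists m1 m2 : {measure set T -> \bar R},
     [/\ forall B, measurable B -> m B <= m1 B + m2 B,
         \int[m1]_t g t <= C%:E & m2 setT < e%:E]) ->
  \int[m]_t g t <= C%:E.
Proof.
move=> g0 mg mC; rewrite ge0_integralTE//; apply: ub_ereal_sup => _ [h hg <-].
apply/lee_addgt0Pr => e e0.
have [M hM] : exists M : R, forall t, (h t <= M)%R.
  have [M [_ hM]] := simple_bounded h; exists (M + 1)%R => t.
  by rewrite (le_trans (ler_norm _))// hM// ltrDl.
have [|n1 [n2 [mn n1C n2e]]] := mC (e / (`|M| + 1))%R.
  by rewrite divr_gt0 ?ltr_wpDl.
have hfin : finite_set (range h) by [].
rewrite sintegralE.
apply: (@le_trans _ _ (\sum_(x \in range h) (x%:E * n1 (h @^-1` [set x]) + x%:E * n2 (h @^-1` [set x])))).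
  apply: lee_fsum => // x [t _ <-].
  by rewrite -ge0_muleDr// lee_wpmul2l ?lee_fin// mn.
rewrite fsbig_split//= -!sintegralE -!integralT_nnsfun leeD//.
  apply: le_trans n1C; apply: ge0_le_integral => //.
    by move=> t _; rewrite lee_fin.
  exact/measurable_EFinP.
apply: (@le_trans _ _ (\int[n2]_t (`|M| + 1)%:E)).
  apply: ge0_le_integral => //.
  - by move=> t _; rewrite lee_fin.
  - exact/measurable_EFinP.
  - move=> t _; rewrite lee_fin (le_trans (hM t))// (le_trans (ler_norm _))//.
    by rewrite lerDl.
rewrite integral_cst//.
have M0 : (0 < `|M| + 1)%R by rewrite ltr_wpDl.
rewrite -(@divfK _ (`|M| + 1)%R _ e) ?gt_eqF// muleC EFinM.
by rewrite lee_wpmul2r// ?lee_fin ?ltW.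
Qed.

End nonneg_integral_bounds.

Section pvm_convergence.
Variables (R : realType) (H : hilbert R) (P : set (measurableTypeR R) -> H -> H).
Hypothesis PP : pvm P.

Lemma pvm_cvg (F : nat -> set (measurableTypeR R)) u (e : R) :
  (forall n, measurable (F n)) -> nondecreasing_seq F ->
  (forall t, exists n, F n t) -> 0 < e ->
  exists n, forall m, (n <= m)%N -> nsq (P (F m) u - u) < e.
Proof.
move=> mF ndF FT e0.
have UF : \bigcup_n F n = setT.
  by rewrite -subTset => t _; have [n Fnt] := FT t; exists n.
have := nondecreasing_cvg_mu (mu := specm PP u) mF.
rewrite UF => /(_ measurableT ndF) /=.
have -> : specm PP u setT = (nsq u)%:E by rewrite -[in RHS](pvmT PP u).
move=> /fine_cvgP[_] /cvgrPdist_lt /(_ _ e0) [n _ nF]; exists n => m /nF /=.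
rewrite -(specm_setC PP u (mF m)) addrAC subrr add0r ger0_norm ?nsq_ge0//.
by rewrite (pvm_setC PP)// nsq_distC.
Qed.

Lemma measurable_cutoff (f : measurableTypeR R -> R) (r : R) :
  measurable_fun setT f -> measurable [set t | `|f t| <= r].
Proof.
move=> mf; rewrite (_ : [set _ | _] = (fun t => `|f t|) @^-1` `]-oo, r]).
  by rewrite -[X in measurable X]setTI; apply: measurableT_comp.
by apply/seteqP; split => t; rewrite /= in_itv.
Qed.

Lemma measurable_nonneg (f : measurableTypeR R -> R) :
  measurable_fun setT f -> measurable [set t | 0 <= f t].
Proof.
move=> mf; rewrite (_ : [set _ | _] = f @^-1` `[0, +oo[).
  by rewrite -[X in measurable X]setTI; apply: mf.
by apply/seteqP; split => t; rewrite /= in_itv/= andbT.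
Qed.

Lemma pvm_cutoff (f : measurableTypeR R -> R) u (e : R) :
  measurable_fun setT f -> 0 < e ->
  exists n : nat, nsq (P [set t | `|f t| <= n%:R] u - u) < e.
Proof.
move=> mf e0.
have [|||n /(_ n (leqnn n))] :=
    @pvm_cvg (fun n => [set t | `|f t| <= n%:R]) u e _ _ _ e0; last by exists n.
- by move=> n; exact: measurable_cutoff.
- move=> m n mn; apply/subsetPset => t /= /le_trans; apply.
  by rewrite ler_nat.
- by move=> t; exists (Num.bound `|f t|); exact/ltW/archi_boundP.
Qed.

End pvm_convergence.

(** * Spectral integrals *)

Section spectral_integral_theory.
Variables (R : realType) (H : hilbert R).
Local Notation T := (measurableTypeR R).
Implicit Types (u v w : H) (B C : set T).

(* For [P B := lmul K (E B)] this unfolds to [is_spectral_integral E f A]. *)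
Definition spectral_int (P : set T -> H -> H) (f : R -> R) (A : set (H * H)) :=
  [/\ [/\ A (0, 0),
        (forall (k : R[i]) p q, A p -> A q -> A (k *: p.1 + q.1, k *: p.2 + q.2)) &
        forall v, A (0, v) -> v = 0],
      (forall u, (exists v, A (u, v)) <->
         (\int[fun B => (ip (P B u) u)%:E]_t ((f t) ^+ 2)%:E < +oo)%E) &
      forall u v, A (u, v) ->
        hdot v u = (fine (\int[fun B => (ip (P B u) u)%:E]_t (f t)%:E)%E)%:C].

Variable P : set T -> H -> H.
Hypothesis PP : pvm P.
Variables (f : T -> R) (A : set (H * H)).
Hypothesis mf : measurable_fun setT f.
Hypothesis fA : spectral_int P f A.

Local Notation nu := (specm PP).

Let mf2 : measurable_fun setT (fun t => (f t ^+ 2)%:E).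
Proof. by apply/measurable_EFinP; exact: measurable_funX. Qed.

Lemma sintP (k : R[i]) u v u' v' :
  A (u, v) -> A (u', v') -> A (k *: u + u', k *: v + v').
Proof. by move=> uv uv'; have [[_ lin _] _ _] := fA; exact: (lin k _ _ uv uv'). Qed.

Lemma sintD u v u' v' : A (u, v) -> A (u', v') -> A (u + u', v + v').
Proof. by move=> uv uv'; have := sintP 1 uv uv'; rewrite !scale1r. Qed.

Lemma sintB u v u' v' : A (u, v) -> A (u', v') -> A (u - u', v - v').
Proof.
move=> uv uv'; have := sintP (-1) uv' uv.
by rewrite !scaleN1r ![- _ + _]addrC.
Qed.

Lemma sintZ k u v : A (u, v) -> A (k *: u, k *: v).
Proof.
move=> uv; have [[A0 _ _] _ _] := fA.
by have := sintP k uv A0; rewrite !addr0.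
Qed.

Lemma sint_fun u v v' : A (u, v) -> A (u, v') -> v = v'.
Proof.
move=> uv uv'; have [[_ _ inj] _ _] := fA; apply/eqP; rewrite -subr_eq0.
by apply/eqP/inj; have := sintB uv uv'; rewrite subrr.
Qed.

Lemma sint_dom u : (exists v, A (u, v)) <-> (\int[nu u]_t (f t ^+ 2)%:E < +oo)%E.
Proof. by have [_ /(_ u) -> _] := fA; rewrite (integral_specm PP). Qed.

Lemma sint_form u v : A (u, v) -> hdot v u = (fine (\int[nu u]_t (f t)%:E))%:C.
Proof. by have [_ _ /(_ u v) fuv] := fA; move=> /fuv; rewrite (integral_specm PP). Qed.

Lemma sint_ip u v : A (u, v) -> ip v u = fine (\int[nu u]_t (f t)%:E).
Proof. by move=> /sint_form; rewrite /ip => ->. Qed.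

Lemma sint_ipi u v : A (u, v) -> ip v ('i *: u) = 0.
Proof. by move=> /sint_form; rewrite ip_ir => ->. Qed.

(** The form is real at u + 'i u'; the vanishing of its imaginary part there is the symmetry. *)
Lemma sint_sym u v u' v' : A (u, v) -> A (u', v') -> ip v u' = ip u v'.
Proof.
move=> uv uv'; have := sint_ipi (sintD uv (sintZ 'i uv')).
rewrite scalerDr ipDr !ipDl (sint_ipi uv) (sint_ipi (sintZ 'i uv')) addr0 add0r.
rewrite ip_ii scalerA -[_ * _]expr2 sqr_i scaleN1r ipNr (ipC u) => /eqP.
by rewrite subr_eq0 => /eqP ->.
Qed.

(** By [specm_split] the measure of P B u is dominated by that of u, so the integral of f^2 stays
    finite. *)
Lemma sint_domP B u : measurable B ->
  (exists v, A (u, v)) -> exists v, A (P B u, v).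
Proof.
move=> mB /sint_dom uf; apply/sint_dom; apply: le_lt_trans uf.
have mC := measurableC mB.
rewrite [leRHS](eq_measure_integral (measure_add (nu (P B u)) (nu (P (~` B) u)))); last first.
  move=> C mC' _; have E := measure_addE (nu (P B u)) (nu (P (~` B) u)) C.
  by refine (eq_trans _ (esym E)); exact: specm_split.
rewrite ge0_integral_measure_add//; last by move=> t _; rewrite lee_fin sqr_ge0.
by rewrite leeDl// integral_ge0// => t _; rewrite lee_fin sqr_ge0.
Qed.

Lemma sint_integrable u v : A (u, v) -> (nu u).-integrable setT (EFin \o f).
Proof.
move=> uv; have /sint_dom uf : exists v, A (u, v) by exists v.
(* |f| <= 1 + f^2, and constants are integrable since the measure is finite. *)
apply: (@le_integrable _ _ _ _ _ measurableT _ (fun t => 1%:E + (f t ^+ 2)%:E)%E) => //.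
- exact/measurable_EFinP.
- move=> t _ /=; rewrite lee_fin [leRHS]ger0_norm ?addr_ge0 ?sqr_ge0//.
  rewrite -real_normK ?num_real//.
  have := sqr_ge0 (`|f t| - 2^-1); rewrite sqrrB !expr2; lra.
- apply: integrableD => //.
    exact: finite_measure_integrable_cst.
  apply/integrableP; split => //.
  by under eq_integral do rewrite gee0_abs ?lee_fin ?sqr_ge0//.
Qed.

Lemma integral_specm_setC u B (g : T -> \bar R) : measurable B ->
  measurable_fun setT g -> nsq (P (~` B) u) = 0 ->
  (\int[nu u]_t g t = \int[nu u]_(t in B) g t)%E.
Proof.
move=> mB mg u0; rewrite -(setUCr B) integral_setU//.
- rewrite [X in (_ + X)%E]null_set_integral ?adde0//.
  + exact: measurableC.
  + exact: measurable_funTS.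
  + by rewrite /= /specm u0.
- exact: measurableC.
- exact: measurable_funTS.
- by apply/disj_setPCl.
Qed.

Lemma sint_dom_bounded B (r : R) u : measurable B ->
  (forall t, B t -> `|f t| <= r) -> exists v, A (P B u, v).
Proof.
move=> mB fr; apply/sint_dom.
rewrite (integral_specm_setC (B := B))//; last first.
  rewrite -(pvmI PP)//; last exact: measurableC.
  by rewrite setICl (pvm_set0 PP) nsq0.
apply: (@le_lt_trans _ _ (\int[nu (P B u)]_(t in B) (r ^+ 2)%:E)%E).
  apply: ge0_le_integral => //.
  - by move=> t _; rewrite lee_fin sqr_ge0.
  - exact: measurable_funTS.
  - move=> t /fr ftr; rewrite lee_fin -real_normK ?num_real//.
    by rewrite lerXn2r// nnegrE// (le_trans _ ftr).
by rewrite integral_cst// lte_mul_pinfty// ?lee_fin ?sqr_ge0// ltry.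
Qed.

Lemma integral_specm_orth B u v v' w : measurable B ->
  A (P B u, v) -> A (P (~` B) w, v') ->
  (\int[nu (P B u + P (~` B) w)%R]_t (f t)%:E =
   \int[nu (P B u)]_t (f t)%:E + \int[nu (P (~` B) w)]_t (f t)%:E)%E.
Proof.
move=> mB uv wv'; have mC := measurableC mB.
rewrite (eq_measure_integral (measure_add (nu (P B u)) (nu (P (~` B) w)))); last first.
  move=> C mC' _; have E := measure_addE (nu (P B u)) (nu (P (~` B) w)) C.
  refine (eq_trans _ (esym E)); rewrite [LHS](specm_split PP _ mB mC').
  rewrite !(pvmD PP)// !(pvmK PP)// -!(pvmI PP)// setICr setICl !(pvm_set0 PP).
  by rewrite addr0 add0r.
rewrite integral_measure_add//.
  exact: sint_integrable uv.
exact: sint_integrable wv'.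
Qed.

Lemma sint_dense u (e : R) : 0 < e -> exists v w, A (v, w) /\ nsq (v - u) < e.
Proof.
move=> e0; have [n Fn] := pvm_cutoff PP u mf e0.
have [|w vw] := sint_dom_bounded u (measurable_cutoff n%:R mf) (r := n%:R).
  by [].
by exists (P [set t | `|f t| <= n%:R] u), w.
Qed.

(* <A (a + b), a + b> = <A a, a> + <A b, b> for a in the range of P B and b in that of
   P (~` B), so the symmetric cross terms vanish. *)
Lemma sint_cross B u v : measurable B -> A (P B u, v) -> P (~` B) v = 0.
Proof.
move=> mB uv; have mC := measurableC mB.
apply: (@orthogonal_dense_eq0 _ _ [set x | exists y, A (x, y)]).
  apply/dense_nsqP => x e e0; have [y [z [yz yx]]] := sint_dense x e0.
  by exists y => //; exists z.
move=> z zA; have [y zy] := sint_domP mC zA.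
rewrite (pvm_ip PP)//.
have := sint_ip (sintD uv zy).
rewrite (integral_specm_orth mB uv zy) fineD; last 2 first.
- exact/integrable_fin_num/sint_integrable/uv.
- exact/integrable_fin_num/sint_integrable/zy.
rewrite -(sint_ip uv) -(sint_ip zy) ipDl !ipDr (ipC y (P B u)).
by rewrite -(sint_sym uv zy); lra.
Qed.

(** By [sint_cross] A maps the domain vectors of each of the two complementary ranges into that
    range, so P B selects the first summand of v. *)
Lemma sint_commute B u v : measurable B -> A (u, v) -> A (P B u, P B v).
Proof.
move=> mB uv; have mC := measurableC mB.
have [w1 uw1] : exists w, A (P B u, w) by apply: sint_domP => //; exists v.
have [w2 uw2] : exists w, A (P (~` B) u, w) by apply: sint_domP => //; exists v.
have vE : v = w1 + w2.
  apply: (sint_fun uv); have := sintD uw1 uw2.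
  by rewrite (pvm_setC PP)// addrC subrK.
suff -> : P B v = w1 by [].
rewrite vE (pvmD PP)//.
have := sint_cross mC uw2; rewrite setCK => ->.
by have := sint_cross mB uw1; rewrite (pvm_setC PP)// addr0 => /subr0_eq.
Qed.

Lemma sint_form_ge B (s : R) u v : measurable B -> (forall t, B t -> s <= f t) ->
  A (u, v) -> s * nsq (P B u) <= ip (P B v) (P B u).
Proof.
move=> mB sf uv; have uv' := sint_commute mB uv.
have intf := sint_integrable uv'.
rewrite (sint_ip uv') -lee_fin fineK ?integrable_fin_num//.
rewrite (integral_specm_setC (B := B))//; last 2 first.
- exact/measurable_EFinP.
- rewrite -(pvmI PP)//; last exact: measurableC.
  by rewrite setICl (pvm_set0 PP) nsq0.
apply: (@le_trans _ _ (\int[nu (P B u)]_(t in B) s%:E)%E).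
  by rewrite integral_cst//= /specm (pvmK PP)// EFinM.
apply: le_integral => //.
- exact: finite_measure_integrable_cst.
- exact: integrableS intf.
- by move=> t /[!inE] /sf; rewrite lee_fin.
Qed.

Lemma sint_form_le B (s : R) u v : measurable B -> (forall t, B t -> f t <= s) ->
  A (u, v) -> ip (P B v) (P B u) <= s * nsq (P B u).
Proof.
move=> mB sf uv; have uv' := sint_commute mB uv.
have intf := sint_integrable uv'.
rewrite (sint_ip uv') -lee_fin fineK ?integrable_fin_num//.
rewrite (integral_specm_setC (B := B))//; last 2 first.
- exact/measurable_EFinP.
- rewrite -(pvmI PP)//; last exact: measurableC.
  by rewrite setICl (pvm_set0 PP) nsq0.
apply: (@le_trans _ _ (\int[nu (P B u)]_(t in B) s%:E)%E); last first.
  by rewrite integral_cst//= /specm (pvmK PP)// EFinM.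
apply: le_integral => //.
- exact: integrableS intf.
- exact: finite_measure_integrable_cst.
- by move=> t /[!inE] /sf; rewrite lee_fin.
Qed.

Lemma nsq_lower_bound (s : R) u v : 0 <= s -> s * nsq u <= `|ip v u| ->
  s ^+ 2 * nsq u <= nsq v.
Proof.
move=> s0 suv; have [u0|u0] := eqVneq (nsq u) 0; first by rewrite u0 mulr0 nsq_ge0.
have pu : 0 < nsq u by rewrite lt0r u0 nsq_ge0.
rewrite -(ler_pM2r pu) (le_trans _ (cauchy_schwarz v u))//.
rewrite -mulrA -expr2 -exprMn -[leRHS]real_normK ?num_real//.
by rewrite lerXn2r// nnegrE mulr_ge0 ?nsq_ge0.
Qed.

(** The form controls the norm only where f has constant sign, so B is cut along the sign of f; the
    two pieces are orthogonal and their squared norms add up. *)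
Lemma sint_nsq_ge B (s : R) u v : measurable B -> 0 <= s ->
  (forall t, B t -> s <= `|f t|) ->
  A (u, v) -> s ^+ 2 * nsq (P B u) <= nsq (P B v).
Proof.
move=> mB s0 sf uv.
pose C := [set t : T | 0 <= f t].
have mC : measurable C by exact: measurable_nonneg.
have mC' := measurableC mC.
have mBC : measurable (C `&` B) by exact: measurableI.
have mBC' : measurable (~` C `&` B) by exact: measurableI.
rewrite -(specm_setC PP (P B u) mC) -(specm_setC PP (P B v) mC) -!(pvmI PP)//.
rewrite mulrDr lerD// nsq_lower_bound//.
  apply: le_trans (ler_norm _); apply: sint_form_ge => // t [/= ft /sf].
  by rewrite ger0_norm.
rewrite -normrN; apply: le_trans (ler_norm _).
rewrite lerNr -mulNr; apply: sint_form_le => // t [/= /negP ft /sf].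
by rewrite ltr0_norm 1?ltNge// lerNr.
Qed.

(** Half of the isometry between v and f in L^2 of the measure of u. On a set where f^2 >= x,
    [sint_nsq_ge] with s = sqrt x compares the measures of u and v. *)
Lemma sint_norm u v : A (u, v) -> (\int[nu u]_t (f t ^+ 2)%:E <= (nsq v)%:E)%E.
Proof.
move=> uv; have -> : (nsq v)%:E = nu v setT by rewrite -[in LHS](pvmT PP v).
apply: ge0_integral_le_measure => [t|x B x0 mB xf].
  by rewrite lee_fin sqr_ge0.
rewrite -EFinM lee_fin -(sqr_sqrtr x0); apply: sint_nsq_ge => //.
move=> t /xf; rewrite lee_fin => xft.
by rewrite -sqrtr_sqr ler_wsqrtr.
Qed.

End spectral_integral_theory.

(** * Positive operators and their square roots *)

Section positive_operators.
Variables (R : realType) (N : tracial_algebra R) (K : L2_space N).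
Local Notation H := (L2 K).
Implicit Types (u v w z : H) (S : set (H * H)).

Section positive_op_theory.
Variable S : set (H * H).
Hypothesis SP : positive_op S.

Lemma posP (k : R[i]) u v u' v' :
  S (u, v) -> S (u', v') -> S (k *: u + u', k *: v + v').
Proof. by move=> uv uv'; have [[_ lin _] _ _] := SP; exact: (lin k _ _ uv uv'). Qed.

Lemma posD u v u' v' : S (u, v) -> S (u', v') -> S (u + u', v + v').
Proof. by move=> uv uv'; have := posP 1 uv uv'; rewrite !scale1r. Qed.

Lemma posB u v u' v' : S (u, v) -> S (u', v') -> S (u - u', v - v').
Proof.
move=> uv uv'; have := posP (-1) uv' uv.
by rewrite !scaleN1r ![- _ + _]addrC.
Qed.

Lemma pos0 : S (0, 0). Proof. by have [[]] := SP. Qed.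

Lemma posZ k u v : S (u, v) -> S (k *: u, k *: v).
Proof. by move=> uv; have := posP k uv pos0; rewrite !addr0. Qed.

Lemma pos_fun u v v' : S (u, v) -> S (u, v') -> v = v'.
Proof.
move=> uv uv'; have [[_ _ inj] _ _] := SP; apply/eqP; rewrite -subr_eq0.
by apply/eqP/inj; have := posB uv uv'; rewrite subrr.
Qed.

Lemma pos_sym u v u' v' : S (u, v) -> S (u', v') -> hdot v u' = hdot u v'.
Proof.
move=> uv; have [_ SE _] := SP; rewrite -{1}SE => /(_ (u, v)); exact.
Qed.

Lemma pos_ip_sym u v u' v' : S (u, v) -> S (u', v') -> ip v u' = ip u v'.
Proof. by move=> uv uv'; rewrite /ip (pos_sym uv uv'). Qed.

Lemma pos_ge0 u v : S (u, v) -> 0 <= ip v u.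
Proof.
move=> uv; have [_ _ /(_ _ uv)] := SP; rewrite /= /ip.
by case: (hdot v u) => a b; rewrite lecE => /andP[].
Qed.

Lemma pos_ipi u v : S (u, v) -> ip v ('i *: u) = 0.
Proof.
move=> uv; have [_ _ /(_ _ uv)] := SP; rewrite /= ip_ir.
by case: (hdot v u) => a b; rewrite lecE => /andP[/eqP].
Qed.

Lemma pos_closed p : closure S p -> S p.
Proof.
move=> /closure_nsqP pS; have [_ SE _] := SP; rewrite -SE => q Sq.
have real_part r : S r -> ip r.2 p.1 = ip r.1 p.2.
  move=> Sr; apply/eqP; rewrite -subr_eq0 -sqrf_eq0 eq_le sqr_ge0 andbT.
  apply/ler_addgt0Pr => e e0; rewrite add0r.
  (* Chosen so that the two Cauchy-Schwarz errors, combined by (a - b)^2 <= 2 a^2 + 2 b^2, stay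
     below e; the 1 keeps M positive. *)
  pose M := 1 + nsq r.1 + nsq r.2.
  have M0 : 0 < M.
    by rewrite /M -addrA ltr_pwDl// addr_ge0 ?nsq_ge0.
  have [|p' [Sp' p1 p2]] := pS (e / (2 * M)); first by rewrite divr_gt0// mulr_gt0.
  have -> : ip r.2 p.1 - ip r.1 p.2 = ip r.1 (p'.2 - p.2) - ip r.2 (p'.1 - p.1).
    have := @pos_ip_sym r.1 r.2 p'.1 p'.2; rewrite -!surjective_pairing !ipBr.
    by move=> /(_ Sr Sp') ->; ring.
  have := cauchy_schwarz r.1 (p'.2 - p.2).
  have := cauchy_schwarz r.2 (p'.1 - p.1).
  move: (ip r.1 _) (ip r.2 _) => a b.
  have := nsq_ge0 r.1; have := nsq_ge0 r.2.
  have := nsq_ge0 (p'.1 - p.1); have := nsq_ge0 (p'.2 - p.2).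
  move: p1 p2; rewrite !ltr_pdivlMr ?mulr_gt0// /M.
  move: (nsq r.1) (nsq r.2) (nsq (p'.1 - p.1)) (nsq (p'.2 - p.2)) => x y s t.
  have := sqr_ge0 (a + b); nra.
rewrite !hdotE; congr (_ +i* _); first exact: real_part.
have := real_part ('i *: q.1, 'i *: q.2); rewrite /= !ip_iC => /(_ _)/oppr_inj -> //.
by apply: posZ; rewrite -surjective_pairing.
Qed.

(* The Cauchy-Schwarz inequality of the positive form <S x, y>. *)
Lemma pos_cauchy_schwarz u v w : S (u, v) -> S (v, w) ->
  nsq v ^+ 2 <= ip v u * ip w v.
Proof.
move=> uv vw; apply: quadratic_discriminant; rewrite ?pos_ge0// => t.
have := pos_ge0 (posD uv (posZ t%:C vw)).
rewrite !ipE (pos_ip_sym vw uv) -/(nsq v); congr (0 <= _); ring.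
Qed.

Definition sqop (S : set (H * H)) : set (H * H) :=
  [set p | exists w, S (p.1, w) /\ S (w, p.2)].

(** The algebraic square is already closed. If S u_n = w_n and S w_n = z_n, then |w_i - w_j|^2 =
    <u_i - u_j, z_i - z_j>, so the middle vectors converge as soon as u_n and z_n do, and S is
    closed. *)
Lemma pos_sq_closed p : mulop S S p -> sqop S p.
Proof.
move=> /closure_nsqP pS.
have e0 n : 0 < (n.+1%:R^-1 : R) by rewrite invr_gt0.
have /choice[q qP] : forall n, exists q : H * H * H,
    [/\ S (q.1.1, q.2), S (q.2, q.1.2), nsq (q.1.1 - p.1) < n.+1%:R^-1 &
        nsq (q.1.2 - p.2) < n.+1%:R^-1].
  by move=> n; have [r [[w [? ?]] ? ?]] := pS _ (e0 n); exists (r, w).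
have small (e : R) : 0 < e -> exists n, forall m, (n <= m)%N ->
    nsq ((q m).1.1 - p.1) < e /\ nsq ((q m).1.2 - p.2) < e.
  move=> e1; exists (Num.bound e^-1) => m nm.
  have me : m.+1%:R^-1 < e.
    rewrite invf_plt ?posrE//.
    apply: (lt_le_trans (archi_boundP _)); first by rewrite invr_ge0 ltW.
    by rewrite ler_nat (leq_trans nm).
  by have [_ _ a b] := qP m; split; [exact: lt_trans a me|exact: lt_trans b me].
have [w ww] : exists w, (fun n => (q n).2) @ \oo --> w.
  apply: cauchy_nsq_cvg => e e1.
  have [|n nP] := small (e / 8); first by rewrite divr_gt0.
  exists n => i j /nP[ui zi] /nP[uj zj].
  have [Sui Szi _ _] := qP i; have [Suj Szj _ _] := qP j.
  rewrite /nsq (pos_ip_sym (posB Sui Suj) (posB Szi Szj)).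
  have := nsq_ge0 ((q i).1.1 - (q j).1.1 - ((q i).1.2 - (q j).1.2)).
  rewrite nsqB.
  have := nsq_dist_le (q i).1.1 p.1 (q j).1.1.
  have := nsq_dist_le (q i).1.2 p.2 (q j).1.2.
  rewrite (nsq_distC p.1) (nsq_distC p.2); lra.
exists w; move/cvg_nsqP in ww; split; apply: pos_closed; apply/closure_nsqP => e e1;
  have [n nP] := small _ e1; have [k _ kP] := ww _ e1;
  have [n1 n2] := nP _ (leq_maxl n k); have [Su Sz _ _] := qP (maxn n k).
- exists ((q (maxn n k)).1.1, (q (maxn n k)).2).
  by split; [exact: Su|exact: n1|exact: (kP _ (leq_maxr n k))].
- exists ((q (maxn n k)).2, (q (maxn n k)).1.2).
  by split; [exact: Sz|exact: (kP _ (leq_maxr n k))|exact: n2].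
Qed.

End positive_op_theory.

End positive_operators.

(** * Spectral subspaces of half-lines and uniqueness of the spectral measure *)

Section rays.
Variable R : realType.
Local Notation T := (measurableTypeR R).

Definition ray (l : R) : set T := [set t | t <= l].

Lemma measurable_ray l : measurable (ray l).
Proof.
rewrite (_ : ray l = `]-oo, l]%classic); first exact: measurable_itv.
by apply/seteqP; split => t; rewrite /ray /= in_itv.
Qed.

Lemma measurable_geset l : measurable ([set t | l <= t] : set T).
Proof.
rewrite (_ : [set t | _] = `[l, +oo[%classic); first exact: measurable_itv.
by apply/seteqP; split => t; rewrite /= in_itv/= andbT.
Qed.

Lemma measurable_ltset l : measurable ([set t | t < l] : set T).
Proof.
rewrite (_ : [set t | _] = `]-oo, l[%classic); first exact: measurable_itv.
by apply/seteqP; split => t; rewrite /= in_itv.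
Qed.

(** Complements of rays form a generating pi-system. Both the family and the vector may vary: one
    use compares two spectral measures at u, another compares S u + 'i u with S u - 'i u. *)
Lemma specm_unique (H : hilbert R) (P P' : set T -> H -> H) (PP : pvm P)
    (PP' : pvm P') (u u' : H) : nsq u = nsq u' ->
  (forall l, nsq (P (ray l) u) = nsq (P' (ray l) u')) ->
  forall B, measurable B -> specm PP u B = specm PP' u' B.
Proof.
move=> uu' ruu' B mB.
apply: (@measure_unique _ R T (@RGenOInfty.G R) (fun n => `]- n%:R, +oo[%classic)).
- exact: RGenOInfty.measurableE.
- move=> _ _ [x ->] [y ->]; exists (Num.max x y).
  apply/seteqP; split => t; rewrite /= !in_itv /= !andbT gt_max.
    by move=> [-> ->].
  by move=> /andP[].
- by move=> n; exists (- n%:R).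
- rewrite -subTset => t _; exists (Num.bound `|t|) => //=.
  rewrite in_itv/= andbT ltrNl.
  apply: le_lt_trans (archi_boundP (normr_ge0 t)).
  by rewrite -normrN ler_norm.
- move=> _ [x ->].
  have -> : `]x, +oo[%classic = ~` ray x.
    apply/seteqP; split => t; rewrite /ray /= in_itv/= andbT ltNge.
      by move/negP.
    by move=> /negP.
  have mx := measurable_ray x.
  congr (_%:E).
  have := specm_setC PP u mx; have := specm_setC PP' u' mx.
  by rewrite uu' ruu' => <- /addrI.
- by move=> n; exact: ltry.
- exact: mB.
Qed.

End rays.

Section positive_spectral.
Variables (R : realType) (N : tracial_algebra R) (K : L2_space N).
Local Notation H := (L2 K).
Implicit Types (u v w z : H).
Local Notation T := (measurableTypeR R).
Variables (P : set T -> H -> H) (A : set (H * H)).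
Hypotheses (PP : pvm P) (pA : positive_op A) (idA : spectral_int P idfun A).

Let mid : measurable_fun setT (idfun : T -> R).
Proof. exact: measurable_id. Qed.

Lemma pvm_nsq_le B u : measurable B -> nsq (P B u) <= nsq u.
Proof. by move=> mB; rewrite -(specm_setC PP u mB) lerDl nsq_ge0. Qed.

Lemma nsq_small u : (forall e : R, 0 < e -> nsq u < e) -> u = 0.
Proof.
move=> ue; apply: nsq_eq0; apply/eqP; rewrite eq_le nsq_ge0 andbT.
by apply/ler_addgt0Pr => e /ue /ltW; rewrite add0r.
Qed.

Lemma pvm_exhaust (F : nat -> set T) u : (forall n, measurable (F n)) ->
  nondecreasing_seq F -> (forall t, exists n, F n t) ->
  (forall n, P (F n) u = 0) -> u = 0.
Proof.
move=> mF ndF FT F0; apply: nsq_small => e e0.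
by have [n /(_ n (leqnn n))] := pvm_cvg PP u mF ndF FT e0; rewrite F0 add0r nsqN.
Qed.

Lemma pvm_sub0 B C u : measurable B -> measurable C -> B `<=` C ->
  P C u = 0 -> P B u = 0.
Proof.
by move=> mB mC BC C0; rewrite -(setIidl BC) (pvmI PP)// C0 (pvm0 PP).
Qed.

Lemma inv_succ_lt (e : R) : 0 < e -> exists n : nat, n.+1%:R^-1 < e.
Proof.
move=> e0; exists (Num.bound e^-1); rewrite invf_plt ?posrE//.
apply: (lt_trans (archi_boundP _)); first by rewrite invr_ge0 ltW.
by rewrite ltr_nat.
Qed.

Lemma inv_succ_le (m n : nat) : (m <= n)%N -> n.+1%:R^-1 <= m.+1%:R^-1 :> R.
Proof. by move=> mn; rewrite lef_pV2 ?posrE// ler_nat. Qed.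

Lemma positive_neg0 u : P [set t | t < 0] u = 0.
Proof.
have mn := measurable_ltset (0 : R).
have on_dom x y : A (x, y) -> P [set t | t < 0] x = 0.
  move=> xy.
  (* These sets exhaust the line and meet the negative half-line in [ray (- n.+1%:R^-1)], where the
     form is at most a negative multiple of the squared norm. *)
  pose F n : set T := ray (- n.+1%:R^-1) `|` [set t | 0 <= t].
  have mr n : measurable (ray (- n.+1%:R^-1 : R)) by exact: measurable_ray.
  have mF n : measurable (F n).
    by apply: measurableU => //; exact: measurable_geset.
  apply: (pvm_exhaust mF) => [m n mn'|t|n].
  - apply/subsetPset => t [tm|t0]; [left|by right].
    by rewrite /ray /= (le_trans tm)// lerN2 inv_succ_le.
  - have [t0|t0] := leP 0 t; first by exists 0%N; right.
    have [|n nt] := @inv_succ_lt (- t); first by rewrite oppr_gt0.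
    by exists n; left; rewrite /ray /= lerNr ltW.
  - rewrite -(pvmI PP)//; apply: (@pvm_sub0 _ (ray (- n.+1%:R^-1))) => //.
    + exact: measurableI.
    + by move=> t [[//|/=]]; rewrite leNgt => /negP.
    have n0 : 0 < (n.+1%:R^-1 : R) by rewrite invr_gt0.
    apply: nsq_eq0; apply/eqP; rewrite eq_le nsq_ge0 andbT.
    have := @sint_form_le _ _ _ PP _ _ mid idA _ (- n.+1%:R^-1) _ _ (mr n) (fun t => id) xy.
    have := pos_ge0 pA (sint_commute PP mid idA (mr n) xy).
    move=> /le_trans /[apply]; rewrite mulNr oppr_ge0 pmulr_rle0//.
apply: nsq_small => e e0.
have [x [y [xy xu]]] := sint_dense PP mid idA u e0.
rewrite -nsqN -[- _](add0r) -(on_dom _ _ xy) -(pvmB PP)//.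
exact: le_lt_trans (pvm_nsq_le _ mn) xu.
Qed.

(** With v = A u and w = A v, the Cauchy-Schwarz inequality of the form of A gives |v|^4 <= <v, u>
    <w, v> <= l |u|^2 l |v|^2. *)
Lemma ray_step (l : R) u : 0 <= l -> P (ray l) u = u ->
  exists v, [/\ A (u, v), P (ray l) v = v & nsq v <= l ^+ 2 * nsq u].
Proof.
move=> l0 Pu; have mr := measurable_ray l.
(* The ray is unbounded below; on [0, l] the identity is bounded, and by [positive_neg0] the rest of
   the ray carries nothing. *)
pose I : set T := [set t | 0 <= t] `&` ray l.
have mI : measurable I by apply: measurableI => //; exact: measurable_geset.
have PIE w : P (ray l) w = w -> P I w = w.
  move=> Pw; rewrite (pvmI PP)//; last exact: measurable_geset.
  rewrite Pw; apply/esym/eqP; rewrite -subr_eq0 -(pvm_setC PP)//; last first.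
    exact: measurable_geset.
  rewrite (_ : ~` _ = [set t : T | t < 0]) ?positive_neg0//.
  by apply/seteqP; split => t /=; rewrite ltNge => /negP.
have Idom w : P (ray l) w = w -> exists w', A (w, w').
  move=> /PIE Iw; have := @sint_dom_bounded _ _ _ PP _ _ mid idA I l w mI.
  by rewrite Iw; apply => t [/= t0 tl]; rewrite ger0_norm.
have [v uv] := Idom _ Pu.
have Pv : P (ray l) v = v.
  by apply/esym/(pos_fun pA uv); rewrite -[X in A (X, _)]Pu; exact: (sint_commute PP mid idA mr uv).
have [w vw] := Idom _ Pv.
exists v; split=> //.
have Pw : P (ray l) w = w.
  by apply/esym/(pos_fun pA vw); rewrite -[X in A (X, _)]Pv; exact: (sint_commute PP mid idA mr vw).
have [v0|v0] := eqVneq (nsq v) 0.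
  by rewrite v0 mulr_ge0 ?sqr_ge0 ?nsq_ge0.
have pv : 0 < nsq v by rewrite lt0r v0 nsq_ge0.
rewrite -(ler_pM2r pv) -expr2 (le_trans (pos_cauchy_schwarz pA uv vw))//.
rewrite (_ : l ^+ 2 * nsq u * nsq v = (l * nsq u) * (l * nsq v)); last by ring.
have vu := @sint_form_le _ _ _ PP _ _ mid idA _ l _ _ mr (fun t => id) uv.
have wv := @sint_form_le _ _ _ PP _ _ mid idA _ l _ _ mr (fun t => id) vw.
rewrite Pu Pv in vu; rewrite Pv Pw in wv.
by rewrite ler_pM// (pos_ge0 pA).
Qed.

Lemma ray_chain (l : R) u : 0 <= l -> P (ray l) u = u ->
  exists w : nat -> H, w 0%N = u /\ forall k,
    [/\ A (w k, w k.+1), P (ray l) (w k) = w k &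
        nsq (w k) <= (l ^+ 2) ^+ k * nsq u].
Proof.
move=> l0 Pu.
have /choice[g gP] : forall v, exists w, P (ray l) v = v ->
    [/\ A (v, w), P (ray l) w = w & nsq w <= l ^+ 2 * nsq v].
  move=> v; have [Pv|nPv] := pselect (P (ray l) v = v); last by exists 0.
  by have [w] := ray_step l0 Pv; exists w.
exists (fun k => iter k g u); split => //.
have Pk k : P (ray l) (iter k g u) = iter k g u.
  by elim: k => //= k /gP[].
move=> k; split => //; first by have [] := gP _ (Pk k).
elim: k => [|k IH]; first by rewrite expr0 mul1r.
have [_ _ /le_trans] := gP _ (Pk k); apply.
by rewrite (exprS _ k) -mulrA ler_wpM2l// exprn_ge0.
Qed.

Lemma geometric_bound (a C p q : R) : 0 <= a -> 0 <= p -> p < q ->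
  (forall k, q ^+ k * a <= C * p ^+ k) -> a = 0.
Proof.
move=> a0 p0 pq aC; have q0 : 0 < q by exact: le_lt_trans pq.
apply/eqP; rewrite eq_le a0 andbT.
have z1 : `|p / q| < 1.
  by rewrite ger0_norm; [rewrite ltr_pdivrMr ?mul1r|rewrite divr_ge0 ?(ltW q0)].
apply: (cvgr_to_ge (cvg_geometric C z1)); near=> k.
have qk : 0 < q ^+ k by rewrite exprn_gt0.
by rewrite /geometric /= expr_div_n mulrA ler_pdivlMr// mulrC.
Unshelve. all: by end_near. Qed.

(** For r > l each application of A^2 multiplies the squared norm of the component over [r, +oo[ by
    at least r^4, which exceeds the allowed rate l^4 unless that component is 0. *)
Lemma ray_of_chain (l : R) (w : nat -> H) (C : R) : 0 <= l ->
  (forall k, sqop A (w k, w k.+1)) ->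
  (forall k, nsq (w k) <= C * (l ^+ 4) ^+ k) -> P (ray l) (w 0%N) = w 0%N.
Proof.
move=> l0 Aw wC; have mr := measurable_ray l.
have far (r : R) : l < r -> P [set t | r <= t] (w 0%N) = 0.
  move=> lr; have r0 : 0 <= r by exact: le_trans (ltW lr).
  have mB := measurable_geset r.
  have rB (t : T) : r <= t -> r <= `|t| by move=> /le_trans; apply; exact: ler_norm.
  apply: nsq_eq0; apply: (@geometric_bound _ C (l ^+ 4) (r ^+ 4)).
  - exact: nsq_ge0.
  - exact: exprn_ge0.
  - by rewrite ltrXn2r.
  - move=> k; apply: le_trans (wC k); apply: le_trans (pvm_nsq_le (w k) mB).
    elim: k => [|k IH]; first by rewrite expr0 mul1r.
    have [x [wx xw]] := Aw k.
    rewrite (exprS _ k) -mulrA (le_trans (ler_wpM2l _ IH)) ?exprn_ge0//.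
    have := sint_nsq_ge PP mid idA mB r0 rB wx.
    have := sint_nsq_ge PP mid idA mB r0 rB xw.
    have := sqr_ge0 r => r20 wk1 wk.
    apply: le_trans wk1; rewrite (exprD r 2 2) -mulrA.
    exact: ler_wpM2l.
suff : P (~` ray l) (w 0%N) = 0 by rewrite (pvm_setC PP)// => /subr0_eq.
have mr' := measurableC mr.
(* An exhaustion of the line that meets the complement of the ray only in sets covered by [far]. *)
pose F n : set T := ray l `|` [set t | l + n.+1%:R^-1 <= t].
have mg n := measurable_geset (l + n.+1%:R^-1 : R).
have mF n : measurable (F n) by apply: measurableU => //; exact: mg.
apply: (pvm_exhaust mF) => [m n mn'|t|n].
- apply/subsetPset => t [tl|tm]; [by left|right => /=].
  by rewrite (le_trans _ tm)// lerD2l inv_succ_le.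
- have [tl|tl] := leP t l; first by exists 0%N; left.
  have [|n nt] := @inv_succ_lt (t - l); first by rewrite subr_gt0.
  by exists n; right; rewrite /= -lerBrDl ltW.
- rewrite -(pvmI PP)//; apply: (@pvm_sub0 _ [set t | l + n.+1%:R^-1 <= t]).
  + exact: measurableI.
  + exact: mg.
  + by move=> t [[]].
  + by apply: far; rewrite ltrDl invr_gt0.
Qed.

Lemma ray_neg0 (l : R) u : l < 0 -> P (ray l) u = 0.
Proof.
move=> l0; apply: (pvm_sub0 (measurable_ray l) (measurable_ltset 0)).
  by move=> t tl; exact: le_lt_trans l0.
exact: positive_neg0.
Qed.

End positive_spectral.

(* The range of [P (ray l)] consists of the vectors whose iterates under the
   operator grow at most geometrically with ratio l, so it depends only on the
   operator. *)
Section spectral_measure_unique.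
Variables (R : realType) (N : tracial_algebra R) (K : L2_space N).
Local Notation H := (L2 K).
Local Notation T := (measurableTypeR R).
Variables (P P' : set T -> H -> H) (A : set (H * H)).
Hypotheses (PP : pvm P) (PP' : pvm P') (pA : positive_op A).
Hypotheses (idA : spectral_int P idfun A) (idA' : spectral_int P' idfun A).

Lemma ray_range (l : R) (u : H) : P (ray l) u = u -> P' (ray l) u = u.
Proof.
have [l0 Pu|l0] := leP 0 l; last by rewrite !(ray_neg0 _ pA _ _ l0)//.
have [w [w0 wP]] := ray_chain PP pA idA l0 Pu.
(* Every second term of a chain for A is a chain for A^2. *)
rewrite -w0; apply: (ray_of_chain PP' idA' (w := fun k => w k.*2) (C := nsq u)) => // k.
  by exists (w k.*2.+1); have [? _ _] := wP k.*2; have [? _ _] := wP k.*2.+1.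
have [_ _] := wP k.*2; rewrite mulrC -exprM.
by rewrite -exprM -mul2n mulnA.
Qed.

End spectral_measure_unique.

Lemma spectral_measure_unique (R : realType) (N : tracial_algebra R)
    (K : L2_space N) (P P' : set (measurableTypeR R) -> L2 K -> L2 K)
    (A : set (L2 K * L2 K)) (PP : pvm P) (PP' : pvm P') (u : L2 K) : positive_op A ->
  spectral_int P idfun A -> spectral_int P' idfun A ->
  forall B, measurable B -> specm PP u B = specm PP' u B.
Proof.
move=> pA idA idA'; apply: specm_unique => // l; congr nsq.
have mr := measurable_ray l.
have PP'E v : P' (ray l) (P (ray l) v) = P (ray l) v.
  by apply: (ray_range PP PP' pA idA idA'); rewrite (pvmK PP).
have P'PE v : P (ray l) (P' (ray l) v) = P' (ray l) v.
  by apply: (ray_range PP' PP pA idA' idA); rewrite (pvmK PP').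
apply/eqP; rewrite -subr_eq0; apply/eqP/nsq_eq0.
(* Both projections fix d, so |d|^2 = <u, P d - P' d> = 0. *)
set d := _ - _; rewrite {1}/nsq {1}/d ipBl (pvm_ip PP)// (pvm_ip PP')//.
by rewrite /d (pvmB PP)// (pvmB PP')// (pvmK PP)// (pvmK PP')// PP'E P'PE subrr.
Qed.

(** * Uniqueness of the positive square root *)

Section square_root_unique.
Variables (R : realType) (N : tracial_algebra R) (K : L2_space N).
Local Notation H := (L2 K).
Local Notation T := (measurableTypeR R).
Implicit Types (u v w z : H).
Variables (P : set T -> H -> H) (A S : set (H * H)).
Hypotheses (PP : pvm P) (pA : positive_op A) (idA : spectral_int P idfun A).
Hypotheses (pS : positive_op S) (SA : mulop S S = mulop A A).

Let mid : measurable_fun setT (idfun : T -> R).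
Proof. exact: measurable_id. Qed.

Lemma sqop_eq p : sqop S p <-> sqop A p.
Proof.
split=> h.
  by apply: (pos_sq_closed pA); rewrite -SA; exact: subset_closure.
by apply: (pos_sq_closed pS); rewrite SA; exact: subset_closure.
Qed.

(** If a is the chain of u under A, then the vectors b_k = S a_k satisfy S^2 b_k = b_(k+2), and
    |b_k|^2 = <a_k, a_(k+2)> has the growth demanded by [ray_of_chain]. *)
Lemma sqrt_ray_dom (l : R) u : 0 <= l -> P (ray l) u = u ->
  exists v, S (u, v) /\ P (ray l) v = v.
Proof.
move=> l0 Pu; have [a [a0 aP]] := ray_chain PP pA idA l0 Pu.
have /choice[b bP] : forall k, exists v, S (a k, v) /\ S (v, a k.+2).
  move=> k; have /sqop_eq[v vP] : sqop A (a k, a k.+2).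
    by exists (a k.+1); have [? _ _] := aP k; have [? _ _] := aP k.+1.
  by exists v.
exists (b 0%N); split; first by rewrite -a0; have [] := bP 0%N.
(* C is the geometric mean of the bounds on a_(2k) and a_(2k+2), divided by (l^4)^k. *)
apply: (ray_of_chain PP idA (w := fun k => b k.*2) (C := l ^+ 2 * nsq u)) => // k.
  apply/sqop_eq; exists (a k.*2.+2).
  by have [_ ?] := bP k.*2; have [? _] := bP k.*2.+2.
have [Sab Sba] := bP k.*2.
have [_ _ a1] := aP k.*2; have [_ _ a2] := aP k.*2.+2.
rewrite -ler_sqr ?nnegrE ?nsq_ge0 ?mulr_ge0 ?exprn_ge0 ?nsq_ge0 ?sqr_ge0//.
rewrite {1}/nsq (pos_ip_sym pS Sab Sba) (le_trans (cauchy_schwarz _ _))//.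
apply: (le_trans (ler_pM (nsq_ge0 _) (nsq_ge0 _) a1 a2)).
rewrite (_ : (l ^+ 2) ^+ k.*2 = (l ^+ 4) ^+ k); last first.
  by rewrite -!exprM -mul2n mulnA.
rewrite (_ : (l ^+ 2) ^+ k.*2.+2 = (l ^+ 4) ^+ k * l ^+ 4); last first.
  by rewrite -!exprM -exprD -[k.*2.+2]addn2 mulnDr -mul2n mulnA.
by rewrite le_eqVlt; apply/orP; left; apply/eqP; ring.
Qed.

(** A symmetric operator that is defined on the range of a projection and preserves it commutes with
    the projection; the equality is tested against every vector v. *)
Lemma sqrt_ray_commute (l : R) u w : S (u, w) -> S (P (ray l) u, P (ray l) w).
Proof.
move=> uw; have mr := measurable_ray l.
have [l0|l0] := leP 0 l; last by rewrite !(ray_neg0 PP pA idA)//; exact: pos0.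
have [y [uy Py]] := sqrt_ray_dom l0 (pvmK PP u mr).
suff -> : P (ray l) w = y by [].
have weak v : ip (P (ray l) w - y) v = 0.
  have [y' [vy' Py']] := sqrt_ray_dom l0 (pvmK PP v mr).
  rewrite ipBl (pvm_ip PP)// (pos_ip_sym pS uw vy') -{1}Py' -(pvm_ip PP)//.
  by rewrite -(pos_ip_sym pS uy vy') -(pvm_ip PP)// Py subrr.
by apply/eqP; rewrite -subr_eq0; apply/eqP/nsq_eq0; exact: weak.
Qed.

(* [P] commutes with [S], so <P_B S u, u> is real and the measures of S u + i u
   and S u - i u coincide; integrating t shows that <A S u, u> is real. *)
Lemma sqrt_comm_real u w s t : S (u, w) -> A (w, s) -> A (u, t) ->
  ip s ('i *: u) = 0.
Proof.
move=> uw ws ut.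
have it := sintZ idA 'i ut.
have iip B v : measurable B -> P B ('i *: v) = 'i *: P B v.
  by move=> mB; rewrite (pvmZ PP).
have same : nsq (w + 'i *: u) = nsq (w - 'i *: u).
  by rewrite nsqD nsqB (pos_ipi pS uw); ring.
have rays l : nsq (P (ray l) (w + 'i *: u)) = nsq (P (ray l) (w - 'i *: u)).
  have mr := measurable_ray l.
  rewrite (pvmD PP)// (pvmB PP)// iip// nsqD nsqB.
  by rewrite (pos_ipi pS (sqrt_ray_commute l uw)); ring.
have eqf : ip (s + 'i *: t) (w + 'i *: u) = ip (s - 'i *: t) (w - 'i *: u).
  rewrite (sint_ip PP idA (sintD idA ws it)) (sint_ip PP idA (sintB idA ws it)).
  congr fine; apply: eq_integral_set_function => B mB.
  exact: specm_unique same rays B mB.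
have symm : ip s ('i *: u) = ip ('i *: t) w by rewrite (sint_sym PP idA ws it) ipC.
move: eqf; rewrite !ipE -symm; lra.
Qed.

(* By polarization of [sqrt_comm_real], Im <A S u, v> is antisymmetric in u and v; as A
   and S are symmetric this says A S = S A. *)
Lemma sqrt_ray_comm (l : R) u w s t r : 0 <= l -> P (ray l) u = u ->
  S (u, w) -> A (w, s) -> A (u, t) -> S (t, r) -> s = r.
Proof.
move=> l0 Pu uw ws ut tr.
have sym v : P (ray l) v = v -> ip (s - r) ('i *: v) = 0.
  move=> Pv.
  have [w' [vw' Pw']] := sqrt_ray_dom l0 Pv.
  have [t' [vt' Pt' _]] := ray_step PP pA idA l0 Pv.
  have [s' [ws' _ _]] := ray_step PP pA idA l0 Pw'.
  have := sqrt_comm_real (posD pS uw vw') (sintD idA ws ws') (sintD idA ut vt').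
  have uz := sqrt_comm_real uw ws ut; have vz := sqrt_comm_real vw' ws' vt'.
  rewrite scalerDr !ipE uz vz.
  rewrite (sint_sym PP idA ws' (sintZ idA 'i ut)).
  have [r' [t'r' _]] := sqrt_ray_dom l0 Pt'.
  rewrite (pos_ip_sym pS vw' (posZ pS 'i tr)).
  have -> : ip v ('i *: r) = - ip r ('i *: v) by rewrite (ipC r) ip_iC opprK.
  lra.
have PE a b : A (a, b) -> P (ray l) a = a -> P (ray l) b = b.
  by move=> ab Pa; have [b' [/(pos_fun pA ab) <-]] := ray_step PP pA idA l0 Pa.
have PSE a b : S (a, b) -> P (ray l) a = a -> P (ray l) b = b.
  by move=> ab Pa; have [b' [/(pos_fun pS ab) <-]] := sqrt_ray_dom l0 Pa.
have Ps := PE _ _ ws (PSE _ _ uw Pu).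
have Pr := PSE _ _ tr (PE _ _ ut Pu).
have mr := measurable_ray l.
apply/eqP; rewrite -subr_eq0; apply/eqP/nsq_eq0.
(* 'i times this vector is s - r, so [sym] yields |s - r|^2 = 0. *)
have := sym (- 'i *: (s - r)); rewrite scalerA mulrN -expr2 sqr_i opprK scale1r; apply.
by rewrite (pvmZ PP)// (pvmB PP)// Ps Pr.
Qed.

(** For y = S u - A u one has A y = - S y, so <S y, y> and <A y, y> are nonnegative with sum 0.
    Hence S y = 0 by [pos_cauchy_schwarz], and |y|^2 = <u, S y - A y> = 0. *)
Lemma sqrt_ray_eq (l : R) u t : 0 <= l -> P (ray l) u = u -> A (u, t) -> S (u, t).
Proof.
move=> l0 Pu ut.
have [w [uw Pw]] := sqrt_ray_dom l0 Pu.
have [t' [/(pos_fun pA ut) <- Pt _]] := ray_step PP pA idA l0 Pu.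
have [s [ws Ps _]] := ray_step PP pA idA l0 Pw.
have [r [tr _]] := sqrt_ray_dom l0 Pt.
have [a [wa _]] := sqrt_ray_dom l0 Pw.
have [b [tb _ _]] := ray_step PP pA idA l0 Pt.
have /sqop_eq[t2 [/= /(pos_fun pA ut) <- /(pos_fun pA tb) ab]] : sqop S (u, a).
  by exists w.
have sr := sqrt_ray_comm l0 Pu uw ws ut tr.
have Sy := posB pS wa tr; have Ay := posB pA ws tb.
move: Sy Ay; rewrite sr ab => Sy Ay.
have Sy0 : ip (a - r) (w - t) = 0.
  apply/eqP; rewrite eq_le (pos_ge0 pS Sy) andbT.
  by have := pos_ge0 pA Ay; rewrite -[r - a]opprB ipNl oppr_ge0.
have mr := measurable_ray l.
have Py : P (ray l) (w - t) = w - t by rewrite (pvmB PP)// Pw Pt.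
have [c [yc Pc]] := sqrt_ray_dom l0 Py.
have [d [cd _]] := sqrt_ray_dom l0 Pc.
have ar : a - r = 0.
  have ca := pos_fun pS Sy yc; apply: nsq_eq0; apply/eqP.
  rewrite -sqrf_eq0 eq_le sqr_ge0 andbT ca.
  by rewrite (le_trans (pos_cauchy_schwarz pS yc cd))// -ca Sy0 mul0r.
suff /subr0_eq <- : w - t = 0 by [].
apply: nsq_eq0; rewrite /nsq {1}[w - t]/(w - t) ipBl.
rewrite (pos_ip_sym pS uw Sy) (pos_ip_sym pA ut Ay) ar.
by rewrite -[r - a]opprB ar oppr0 !ip0r subrr.
Qed.

Lemma sqrt_unique : S = A.
Proof.
have AS p : A p -> S p.
  case: p => u v uv; apply: (pos_closed pS); apply/closure_nsqP => e e0.
  have mF n : measurable (ray n%:R : set T) by exact: measurable_ray.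
  have ndF : nondecreasing_seq (fun n => ray n%:R : set T).
    by move=> m n mn; apply/subsetPset => t /= /le_trans; apply; rewrite ler_nat.
  have FT (t : T) : exists n, ray n%:R t.
    exists (Num.bound `|t|); rewrite /ray /= (le_trans (ler_norm _))//.
    exact/ltW/archi_boundP.
  have [n nP] := pvm_cvg PP u mF ndF FT e0.
  have [m mP] := pvm_cvg PP v mF ndF FT e0.
  pose k := maxn n m; exists (P (ray k%:R) u, P (ray k%:R) v).
  split; [|exact: nP (leq_maxl n m)|exact: mP (leq_maxr n m)].
  apply: (@sqrt_ray_eq k%:R); rewrite ?(pvmK PP)//.
  exact: (sint_commute PP mid idA (mF k) uv).
(* S extends A, so passing to adjoints gives the reverse inclusion. *)
apply/seteqP; split => // p Sp.
have [_ <- _] := pA; have [_ SE _] := pS.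
by move=> q /AS Sq; move: Sp; rewrite -{1}SE; exact.
Qed.

End square_root_unique.

Lemma absop_positive (R : realType) (N : tracial_algebra R) (K : L2_space N)
    (P : set (measurableTypeR R) -> L2 K -> L2 K) (A : set (L2 K * L2 K)) :
  pvm P -> positive_op A -> spectral_int P idfun A -> absop A = A.
Proof.
move=> PP pA idA; have [_ AE _] := pA; rewrite /absop AE.
case: xgetP => [S -> [pS SA]|/(_ A)[]]; last by split.
exact: sqrt_unique PP pA idA pS SA.
Qed.

(** * Absolute values *)

Section spectral_integral_adjoint.
Variables (R : realType) (N : tracial_algebra R) (K : L2_space N).
Local Notation H := (L2 K).
Local Notation T := (measurableTypeR R).
Implicit Types (u v w z : H).
Variables (P : set T -> H -> H) (f : T -> R) (A : set (H * H)).
Hypotheses (PP : pvm P) (mf : measurable_fun setT f) (fA : spectral_int P f A).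

(** Since |a + b|^2 <= 2 |a|^2 + 2 |b|^2, the measure of u is dominated by the sum of those of 2 v
    and 2 (u - v); scaling the vectors keeps both of the form [specm]. *)
Lemma specm_lsc u (g : T -> \bar R) (C : R) : (forall t, (0 <= g t)%E) ->
  measurable_fun setT g ->
  (forall e : R, 0 < e -> exists v, nsq (v - u) < e /\
     (\int[specm PP (2%:C *: v)]_t g t <= C%:E)%E) ->
  (\int[specm PP u]_t g t <= C%:E)%E.
Proof.
move=> g0 mg uC; apply: ge0_integral_le_lsc => // e e0.
have [|v [vu vC]] := uC (e / 4); first by rewrite divr_gt0.
exists (specm PP (2%:C *: v)), (specm PP (2%:C *: (u - v))).
have nsq2 (a : H) : nsq (2%:C *: a) = 4 * nsq a by rewrite /nsq !ipE; ring.
split => [B mB||//].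
- rewrite -EFinD lee_fin !(pvmZ PP)// !nsq2 (pvmB PP)//.
  have := nsqD_le (P B v) (P B u - P B v); rewrite addrC subrK.
  have := nsq_ge0 (P B v); have := nsq_ge0 (P B u - P B v); lra.
- exact: vC.
- rewrite [X in (X < _)%E](_ : _ = (nsq (2%:C *: (u - v)))%:E); last first.
    by rewrite -[in RHS](pvmT PP (2%:C *: (u - v))).
  by rewrite lte_fin nsq2 nsq_distC; lra.
Qed.

(** Cutting a pair of the adjoint by a set where f is bounded puts it into A. What remains is that x
    itself lies in the domain; then y is determined by its products with the dense domain. *)
Lemma adjop_sint : adjop A = A.
Proof.
apply/seteqP; split => -[x y]; last first.
  by move=> xy -[u v] uv; rewrite /= !hdotE (sint_sym PP fA uv xy) (sint_sym PP fA uv (sintZ fA 'i xy)).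
move=> xyA; pose F n := [set t : T | `|f t| <= n%:R].
have mF n : measurable (F n) by exact: measurable_cutoff.
have dF n u : exists v, A (P (F n) u, v) /\ P (F n) v = v.
  have [|v uv] := sint_dom_bounded PP mf fA u (mF n) (r := n%:R); first by [].
  exists v; split=> //; have := sint_commute PP mf fA (mF n) uv.
  by rewrite (pvmK PP)// => /(sint_fun fA uv).
have AF n : A (P (F n) x, P (F n) y).
  have [z [xz Pz]] := dF n x.
  suff -> : P (F n) y = z by [].
  have weak v : ip (z - P (F n) y) v = 0.
    have [w [vw Pw]] := dF n v.
    have /= yx := xyA _ vw.
    rewrite ipBl -{1}Pz (pvm_ip PP)// (sint_sym PP fA xz vw) (pvm_ip PP)// Pw.
    by rewrite (pvm_ip PP)// (ipC x) (ipC y) /ip yx subrr.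
  by apply/esym/eqP; rewrite -subr_eq0; apply/eqP/nsq_eq0; exact: weak.
have [z xz] : exists z, A (x, z).
  (* By [sint_norm] the measure of 2 P (F n) x integrates f^2 to at most 4 |P (F n) y|^2 <= 4 |y|^2,
     uniformly in n. *)
  apply/(sint_dom PP fA); apply: (@le_lt_trans _ _ (4 * nsq y)%:E); last exact: ltry.
  apply: specm_lsc => [t||e e0].
  - by rewrite lee_fin sqr_ge0.
  - by apply/measurable_EFinP; exact: measurable_funX.
  have [n Fn] := pvm_cutoff PP x mf e0.
  exists (P (F n) x); split=> //.
  have := sint_norm PP mf fA (sintZ fA 2%:C (AF n)) => /le_trans; apply.
  rewrite lee_fin (_ : nsq (2%:C *: _) = 4 * nsq (P (F n) y)).
    by rewrite ler_pM2l// (pvm_nsq_le PP).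
  by rewrite /nsq !ipE; ring.
suff <- : z = y by [].
apply/eqP; rewrite -subr_eq0; apply/eqP.
apply: (@orthogonal_dense_eq0 _ _ [set u | exists v, A (u, v)]).
  apply/dense_nsqP => u e e0; have [a [b [ab au]]] := sint_dense PP mf fA u e0.
  by exists a => //; exists b.
move=> v [w vw]; have /= yx := xyA _ vw.
by rewrite ipBl (sint_sym PP fA xz vw) (ipC x) (ipC y) /ip yx subrr.
Qed.

End spectral_integral_adjoint.

Section absolute_value.
Variables (R : realType) (N : tracial_algebra R) (K : L2_space N).
Local Notation H := (L2 K).
Local Notation T := (measurableTypeR R).
Implicit Types (u v w z : H).
Variables (P : set T -> H -> H) (f : T -> R) (A : set (H * H)).
Hypotheses (PP : pvm P) (mf : measurable_fun setT f) (fA : spectral_int P f A).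

Let C : set T := [set t | 0 <= f t].

Let mC : measurable C. Proof. exact: measurable_nonneg. Qed.

Let mC' : measurable (~` C). Proof. exact: measurableC. Qed.

(* |A| is (sgn A) A; the sign is the difference of two projections, so that no
   operator has to be constructed by a limit. *)
Definition sgnop u := P [set t | 0 <= f t] u - P (~` [set t | 0 <= f t]) u.

Definition abs_sint : set (H * H) := [set p | exists2 v, A (p.1, v) & p.2 = sgnop v].

Lemma sgnopP (k : R[i]) u v : sgnop (k *: u + v) = k *: sgnop u + sgnop v.
Proof.
rewrite /sgnop !(pvmP PP)//.
by rewrite opprD addrACA -scalerN -scalerDr.
Qed.

Lemma sgnopK u : sgnop (sgnop u) = u.
Proof.
rewrite /sgnop !(pvmB PP)// !(pvmK PP)// -!(pvmI PP)// setICr setICl.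
rewrite !(pvm_set0 PP) subr0 sub0r opprK.
by rewrite (pvm_setC PP)// addrC subrK.
Qed.

Lemma sgnop_commute u v : A (u, v) -> A (sgnop u, sgnop v).
Proof.
move=> uv; apply: (sintB fA); exact: (sint_commute PP mf fA _ uv).
Qed.

Lemma integral_specm_split (g : T -> \bar R) u : measurable_fun setT g ->
  (specm PP (P C u)).-integrable setT g -> (specm PP (P (~` C) u)).-integrable setT g ->
  (\int[specm PP u]_t g t =
   \int[specm PP (P C u)]_t g t + \int[specm PP (P (~` C) u)]_t g t)%E.
Proof.
move=> mg g1 g2.
rewrite [LHS](eq_measure_integral (measure_add (specm PP (P C u)) (specm PP (P (~` C) u)))); last first.
  move=> B mB _; have E := measure_addE (specm PP (P C u)) (specm PP (P (~` C) u)) B.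
  by refine (eq_trans _ (esym E)); exact: specm_split.
exact: integral_measure_add.
Qed.

Lemma abs_sint_form u v : A (u, v) ->
  hdot (sgnop v) u = (fine (\int[specm PP u]_t (`|f t|)%:E))%:C.
Proof.
move=> uv.
have uv1 := sint_commute PP mf fA mC uv.
have uv2 := sint_commute PP mf fA mC' uv.
have PP0 B w : measurable B -> nsq (P (~` B) (P B w)) = 0.
  move=> mB; rewrite -(pvmI PP)//; last exact: measurableC.
  by rewrite setICl (pvm_set0 PP) nsq0.
have i1 := sint_integrable PP mf fA uv1.
have i2 := sint_integrable PP mf fA uv2.
have mabs : measurable_fun setT (fun t => (`|f t|)%:E).
  by apply/measurable_EFinP; exact: measurableT_comp.
have E1 : (\int[specm PP (P C u)]_t (`|f t|)%:E = \int[specm PP (P C u)]_t (f t)%:E)%E.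
  rewrite !(@integral_specm_setC _ _ _ _ _ C) ?PP0//; last exact/measurable_EFinP.
  by apply: eq_integral => t /[!inE] t0; rewrite ger0_norm.
have E2 : (\int[specm PP (P (~` C) u)]_t (`|f t|)%:E = - \int[specm PP (P (~` C) u)]_t (f t)%:E)%E.
  rewrite !(@integral_specm_setC _ _ _ _ _ (~` C)) ?PP0//; last exact/measurable_EFinP.
  rewrite -integralN; last first.
    rewrite fin_num_adde_defl// fin_numN integrable_neg_fin_num//.
    exact: integrableS i2.
  apply: eq_integral => t /[!inE] /negP t0.
  by rewrite ltr0_norm ?ltNge.
rewrite /sgnop linearBl /= -/C.
rewrite -(pvmK PP v mC) (pvm_hdot PP)// (sint_form PP fA uv1).
rewrite -(pvmK PP v mC') (pvm_hdot PP)// (sint_form PP fA uv2).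
rewrite (integral_specm_split (g := fun t => (`|f t|)%:E))//.
- have f1 := integrable_fin_num measurableT i1.
  have f2 := integrable_fin_num measurableT i2.
  by rewrite E1 E2 (fineD f1) ?fin_numN// fineN raddfB.
- exact: integrable_abse i1.
- exact: integrable_abse i2.
Qed.

Lemma abs_sintP : spectral_int P (fun t => `|f t|) abs_sint.
Proof.
have [[A0 Alin Afun] _ _] := fA.
split.
- split.
  + by exists 0 => //; rewrite /sgnop !(pvm0 PP)// subrr.
  + move=> k [u v] [u' v'] [w /= uw ->] [w' /= uw' ->].
    by exists (k *: w + w'); [exact: (Alin k _ _ uw uw')|rewrite sgnopP].
  + move=> v [w /= /Afun -> ->].
    by rewrite /sgnop !(pvm0 PP)// subrr.
- move=> u; rewrite (integral_specm PP).
  rewrite (eq_integral (fun t => (f t ^+ 2)%:E)); last first.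
    by move=> t _; rewrite real_normK ?num_real.
  rewrite -(sint_dom PP fA); split => [[v [w uw _]]|[w uw]]; first by exists w.
  by exists (sgnop w), w.
- move=> u v [w /= uw ->]; rewrite (integral_specm PP).
  exact: abs_sint_form.
Qed.

Lemma abs_sint_positive : positive_op abs_sint.
Proof.
split; first by have [] := abs_sintP.
  by apply: (adjop_sint PP _ abs_sintP); exact: measurableT_comp.
move=> [u v] [w /= uw ->]; rewrite abs_sint_form// lecR.
by rewrite fine_ge0// integral_ge0.
Qed.

(** The sign commutes with A and squares to the identity, so the squares agree even before taking
    closures. *)
Lemma mulop_abs_sint : mulop abs_sint abs_sint = mulop A A.
Proof.
congr closure; apply/seteqP; split => -[u z] [w /=].
- move=> [[v /= uv ->] [v' /= /sgnop_commute]]; rewrite sgnopK => vv' ->.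
  by exists v.
- move=> [uw wz]; exists (sgnop w); split; first by exists w.
  by exists (sgnop z); [exact: sgnop_commute|rewrite /= sgnopK].
Qed.

End absolute_value.

(** * Left multiplication and the determinant *)

Section left_multiplication.
Variables (R : realType) (N : tracial_algebra R) (K : L2_space N).
Local Notation H := (L2 K).
Local Notation T := (measurableTypeR R).
Implicit Types (u v : H) (x y z : op N) (E : set T -> op N).

Lemma talg_id : talg (idfun : op N).
Proof. by have [_ []] := talg_vn N. Qed.

Lemma talg_comp x y : talg x -> talg y -> talg (x \o y).
Proof. by have [_ [_ [_ [+ _]]]] := talg_vn N; exact. Qed.

Lemma talg_adjoint x : talg x -> exists2 z, talg z & adjoint_pair x z.
Proof. by have [_ [_ [_ [_ [+ _]]]]] := talg_vn N; exact. Qed.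

Lemma continuous_nsq (F : H -> H) u (e : R) : continuous F -> 0 < e ->
  exists2 d : R, 0 < d & forall v, nsq (v - u) < d -> nsq (F v - F u) < e.
Proof.
move=> Fc e0; have : nbhs u (F @^-1` [set v | nsq (v - F u) < e]).
  by apply: Fc; apply/nbhs_nsqP; exists e.
by move=> /nbhs_nsqP[d d0 dF]; exists d.
Qed.

(* It suffices to check a continuous identity on the dense image of M. *)
Lemma L2_of_ind (F G : H -> H) a b : continuous F -> continuous G ->
  (forall x, talg x -> ip (F (L2_of K x)) a = ip (G (L2_of K x)) b) ->
  forall u, ip (F u) a = ip (G u) b.
Proof.
move=> Fc Gc FG u; apply/eqP; rewrite -subr_eq0 -sqrf_eq0 eq_le sqr_ge0 andbT.
apply/ler_addgt0Pr => e e0; rewrite add0r.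
pose M := 1 + nsq a + nsq b.
have M0 : 0 < M by rewrite /M -addrA ltr_pwDl// addr_ge0 ?nsq_ge0.
have e1 : 0 < e / (2 * M) by rewrite divr_gt0// mulr_gt0.
have [d1 d10 Fd] := continuous_nsq u Fc e1.
have [d2 d20 Gd] := continuous_nsq u Gc e1.
have dmin : 0 < Num.min d1 d2 by rewrite lt_min d10.
have /dense_nsqP/(_ u _ dmin)[_ [x xM <-]] := @L2_of_dense _ _ K.
rewrite lt_min => /andP[/Fd Fu /Gd Gu].
have -> : ip (F u) a - ip (G u) b =
    ip (G (L2_of K x) - G u) b - ip (F (L2_of K x) - F u) a.
  by rewrite !ipBl FG//; ring.
have := cauchy_schwarz (F (L2_of K x) - F u) a.
have := cauchy_schwarz (G (L2_of K x) - G u) b.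
have := nsq_ge0 a; have := nsq_ge0 b.
have := nsq_ge0 (F (L2_of K x) - F u); have := nsq_ge0 (G (L2_of K x) - G u).
move: Fu Gu; rewrite !ltr_pdivlMr ?mulr_gt0// /M.
move: (ip (F _ - _) a) (ip (G _ - _) b) => p q.
move: (nsq a) (nsq b) (nsq (F (L2_of K x) - F u)) (nsq (G (L2_of K x) - G u)) => r s t w.
have := sqr_ge0 (p + q); nra.
Qed.

Lemma L2_of_eq (F G : H -> H) : continuous F -> continuous G ->
  (forall x, talg x -> F (L2_of K x) = G (L2_of K x)) -> F =1 G.
Proof.
move=> Fc Gc FG u; apply/eqP; rewrite -subr_eq0; apply/eqP/nsq_eq0.
rewrite /nsq [in LHS]ipBl; apply/eqP; rewrite subr_eq0; apply/eqP.
by apply: L2_of_ind => // x xM; rewrite FG.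
Qed.

Lemma lmul_linear x : talg x -> linear (lmul K x).
Proof. by move=> /(lmul_bounded K)[]. Qed.

Lemma lmul_continuous x : talg x -> continuous (lmul K x).
Proof. by move=> /(lmul_bounded K)[]. Qed.

Lemma lmul_id u : lmul K idfun u = u.
Proof.
apply: (L2_of_eq (F := lmul K idfun) (G := idfun)).
- exact/lmul_continuous/talg_id.
- by move=> v; exact: cvg_id.
- by move=> x xM; rewrite lmul_L2_of//; exact: talg_id.
Qed.

Lemma lmul_comp x y u : talg x -> talg y -> lmul K (x \o y) u = lmul K x (lmul K y u).
Proof.
move=> xM yM; apply: (L2_of_eq (F := lmul K (x \o y)) (G := lmul K x \o lmul K y)).
- exact/lmul_continuous/talg_comp.
- move=> v; apply: continuous_comp; exact: lmul_continuous.
- move=> z zM; rewrite /= !lmul_L2_of//; first exact: talg_comp.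
  exact: talg_comp.
Qed.

Lemma lmul_adjoint x z u v : talg x -> talg z -> adjoint_pair x z ->
  hdot (lmul K x u) v = hdot u (lmul K z v).
Proof.
move=> xM zM xz.
(* On the image of M both sides are the trace of w^* x y. *)
have L2E y w : talg y -> talg w ->
    hdot (lmul K x (L2_of K y)) (L2_of K w) = hdot (L2_of K y) (lmul K z (L2_of K w)).
  move=> yM wM; have [w' w'M ww'] := talg_adjoint wM.
  rewrite !lmul_L2_of// (L2_of_dot K wM (talg_comp xM yM) w'M ww').
  rewrite (@L2_of_dot _ _ K (z \o w) y (w' \o x))//; try exact: talg_comp.
  move=> a b /=; rewrite hdotC -xz -hdotC; exact: ww'.
have cid : continuous (idfun : H -> H) by move=> w; exact: cvg_id.
have E1 w : talg w -> forall u, ip (lmul K x u) (L2_of K w) = ip u (lmul K z (L2_of K w)).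
  move=> wM; apply: (L2_of_ind (F := lmul K x) (G := idfun)) => //.
    exact: lmul_continuous.
  by move=> y yM; rewrite /ip L2E.
have E2 u' v' : ip (lmul K x u') v' = ip u' (lmul K z v').
  rewrite ipC [RHS]ipC.
  apply: (L2_of_ind (F := idfun) (G := lmul K z)) => //; first exact: lmul_continuous.
  by move=> w wM; rewrite ipC E1// ipC.
have lin := lmul_linear zM.
have z0 : lmul K z 0 = 0.
  by have := lin (-1) 0 0; rewrite scaler0 add0r scaleN1r addNr.
have zi : lmul K z ('i *: v) = 'i *: lmul K z v.
  by have := lin 'i v 0; rewrite z0 !addr0.
by rewrite !hdotE !E2 zi.
Qed.

Lemma projection_measure_pvm E : projection_measure K E ->
  pvm (fun B => lmul K (E B)).
Proof.
move=> [EM EI ET Eadd]; split.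
- by move=> B /EM[BM _]; exact: lmul_linear.
- by move=> B u v /EM[BM BB]; exact: lmul_adjoint.
- move=> B C u mB mC; rewrite EI// lmul_comp//; first by have [] := EM _ mB.
  by have [] := EM _ mC.
- by move=> u; rewrite ET lmul_id.
- exact: Eadd.
Qed.

Lemma projection_measure_pushforward E (h : T -> T) : measurable_fun setT h ->
  projection_measure K E -> projection_measure K (fun B => E (h @^-1` B)).
Proof.
move=> mh [EM EI ET Eadd].
have mpre (B : set T) : measurable B -> measurable (h @^-1` B : set T).
  by move=> mB; rewrite -[X in measurable X]setTI; exact: mh.
split.
- by move=> B /mpre; exact: EM.
- by move=> B C /mpre mB /mpre mC; rewrite -EI.
- by rewrite preimage_setT.
- move=> u F mF tF mUF.
  rewrite /spectral_form preimage_bigcup.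
  apply: (Eadd u (fun n => h @^-1` F n)).
  + by move=> n; exact: mpre.
  + apply/trivIsetP => i j _ _ ij; rewrite -preimage_setI.
    by move/trivIsetP : tF => ->//; rewrite preimage_set0.
  + by rewrite -preimage_bigcup; exact: mpre.
Qed.

(** This turns the measure mu_|a| into the scalar spectral measure of the unit xi. *)
Lemma trace_ip x : talg x ->
  complex.Re (trace x) = ip (lmul K x (L2_of K idfun)) (L2_of K idfun).
Proof.
move=> xM; rewrite lmul_L2_of//; last exact: talg_id.
rewrite /ip (@L2_of_dot _ _ K idfun (x \o idfun) idfun)//; exact: talg_id.
Qed.

End left_multiplication.

(** * The logarithm and the Fuglede-Kadison determinant *)

Section log_determinant.
Variables (R : realType) (N : tracial_algebra R) (K : L2_space N).
Local Notation H := (L2 K).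
Local Notation T := (measurableTypeR R).
Implicit Types (A L : set (H * H)) (E : set T -> op N).

Local Notation xi := (L2_of K idfun).

(** Change of variables: the image of P under h is a spectral measure of the integral of h. *)
Lemma spectral_int_pushforward (P : set T -> H -> H) (h : T -> T) A (PP : pvm P) :
  measurable_fun setT h -> spectral_int P h A ->
  spectral_int (fun B => P (h @^-1` B)) idfun A.
Proof.
move=> mh hA; have [lin _ _] := hA.
have mid : measurable_fun setT (fun t : T => (t : R)%:E).
  by apply/measurable_EFinP; exact: measurable_id.
have push u (g : T -> \bar R) :
    (\int[fun B => (ip (P (h @^-1` B) u) u)%:E]_t g t =
     \int[pushforward (specm PP u) h]_t g t)%E.
  apply: eq_integral_set_function => B mB.
  rewrite /pushforward specmE//.
  by rewrite -[X in measurable X]setTI; exact: mh.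
split => // [u|u v uv].
- rewrite push ge0_integral_pushforward//; last 2 first.
  + by apply/measurable_EFinP; apply: measurable_funX; exact: measurable_id.
  + by move=> t _; rewrite lee_fin sqr_ge0.
  by rewrite preimage_setT (sint_dom PP hA).
- rewrite (sint_form PP hA uv) push integral_pushforward//.
  rewrite preimage_setT; exact: (sint_integrable PP mh hA uv).
Qed.

Lemma affiliated_nonempty A : affiliated A -> A <> set0.
Proof. by move=> [[A0 _ _] _ _ _] AE; move: A0; rewrite AE. Qed.

(* The junk value of [mu_abs] has integral 0 (a sum of infinite support is 0), so
   [in_L2 L] alone gives no spectral measure of |L|; it is the image of E under |ln|. *)
Lemma absop_spectral E L : projection_measure K E ->
  is_spectral_integral E (@ln R) L ->
  exists E', spectral_measure E' (absop L) /\
    forall u, (exists v, absop L (u, v)) <-> (exists v, L (u, v)).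
Proof.
move=> EP lnL; have PP := projection_measure_pvm EP.
have mln : measurable_fun setT (@ln R : T -> R) by exact: measurable_ln.
pose Q := abs_sint (fun B => lmul K (E B)) (@ln R) L.
have pQ : positive_op Q := abs_sint_positive PP mln lnL.
have mabs : measurable_fun setT (fun t : T => `|ln t|) by exact: measurableT_comp.
have EP' := projection_measure_pushforward mabs EP.
have idQ := spectral_int_pushforward PP mabs (abs_sintP PP mln lnL).
have PP' := projection_measure_pvm EP'.
have -> : absop L = Q.
  rewrite /absop (adjop_sint PP mln lnL) -(mulop_abs_sint PP mln lnL).
  case: xgetP => [S -> [pS SQ]|/(_ Q)[]]; last by split.
  exact: sqrt_unique PP' pQ idQ pS SQ.
exists (fun B => E ((fun t => `|ln t|) @^-1` B)); split; first by split.
move=> u; split=> [[v [w uw _]]|[w uw]]; first by exists w.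
by exists (sgnop (fun B => lmul K (E B)) (@ln R) w), w.
Qed.

(** The source of every spectral measure of A: an affiliated graph contains (0, 0), which rules out
    the default value of [fun_calc]. *)
Lemma logop_spectral A : affiliated (logop A) -> exists E,
  spectral_measure E A /\ is_spectral_integral E (@ln R) (logop A).
Proof.
move=> /affiliated_nonempty; rewrite /logop /fun_calc.
by case: xgetP => // S -> [E]; exists E.
Qed.

Lemma mu_absP E A : spectral_measure E (absop A) -> exists E',
  spectral_measure E' (absop A) /\ mu_abs A = fun B => (complex.Re (trace (E' B)))%:E.
Proof.
move=> EA; rewrite /mu_abs; case: xgetP => [m -> //|].
by move=> /(_ (fun B => (complex.Re (trace (E B)))%:E))[]; exists E.
Qed.

Lemma trace_spectral E B : projection_measure K E -> measurable B ->
  (complex.Re (trace (E B)))%:E = (ip (lmul K (E B) xi) xi)%:E.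
Proof. by move=> [EM _ _ _] mB; rewrite (trace_ip K)//; have [] := EM _ mB. Qed.

(** A finite 2-norm of log A is a finite second moment of the measure of xi for |log A|, hence xi
    lies in the domain of |log A|, which is that of log A. *)
Lemma logop_unit A : in_L2 (logop A) ->
  exists v, logop A (xi, v) /\ L2_vector (logop A) = v.
Proof.
move=> [affL normL]; have [E [[EP idA] lnL]] := logop_spectral affL.
have [E' [EL domL]] := absop_spectral EP lnL.
have [E'' [[EP'' [_ dE'' _]] muE]] := mu_absP EL.
have [v xv] : exists v, logop A (xi, v).
  apply/domL/dE''; rewrite ltey; apply: contraTN normL => /eqP xoo.
  rewrite -leNgt leye_eq /norm2 muE.
  rewrite (eq_integral_set_function (m2 := fun B => (ip (lmul K (E'' B) xi) xi)%:E)).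
    by rewrite xoo poweRyr ?invr_neq0.
  by move=> B mB; exact: trace_spectral.
exists v; split=> //; rewrite /L2_vector.
case: xgetP => [w -> xw|/(_ v)//].
exact: (sint_fun lnL xw xv).
Qed.

(** Both sides integrate [ln] against <E xi, xi>. The spectral measure chosen in [mu_abs] may differ
    from the one behind [logop]; they are matched by |A| = A and uniqueness. *)
Lemma log_fk_det A : positive_op A -> in_L2 (logop A) ->
  fk_det A = expR (ip (L2_vector (logop A)) xi).
Proof.
move=> pA LA; have [v [xv ->]] := logop_unit LA.
have [E [[EP idA] lnL]] := logop_spectral LA.1.
have PP := projection_measure_pvm EP.
rewrite (sint_ip PP lnL xv) /fk_det; congr (expR (fine _)).
have absA : absop A = A := absop_positive PP pA idA.
have [E' [EA' ->]] : exists E', spectral_measure E' A /\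
    mu_abs A = fun B => (complex.Re (trace (E' B)))%:E.
  by rewrite -{1}absA; apply: (@mu_absP E); rewrite absA.
have PP' := projection_measure_pvm EA'.1.
rewrite (eq_integral_set_function (m2 := specm PP xi)); last first.
  move=> B mB; rewrite trace_spectral//; last exact: EA'.1.
  rewrite (spectral_measure_unique PP PP' xi pA idA EA'.2 mB).
  by rewrite specmE.
(* Restricting to ]0, +oo[ changes nothing, as [ln] is 0 elsewhere. *)
rewrite integral_mkcond; apply: eq_integral => t _.
rewrite patchE; case: ifPn => // /negP; rewrite inE /= in_itv /= andbT => /negP.
by rewrite -leNgt => t0; rewrite ln0.
Qed.

(** The default value of [absop] is empty, hence not linear, and has no spectral measure. *)
Lemma absop_positive_op A : in_L2 (logop (absop A)) -> positive_op (absop A).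
Proof.
move=> [/logop_spectral[E [[_ [[A0 _ _] _ _]] _]] _].
by move: A0; rewrite /absop; case: xgetP => [S -> []|].
Qed.

End log_determinant.

Theorem theorem1p4 (R : realType)
    (d : measure_display) (X : measurableType d) (mu : probability X R)
    (X_standard : standard_borel R X)
    (f g : X -> X) (fK : cancel f g) (gK : cancel g f)
    (g_measurable : measurable_fun setT g)
    (f_preserving : measure_preserving mu f) (f_ergodic : ergodic mu f)
    (N : tracial_algebra R) (K : L2_space N)
    (c : int -> X -> op N)
    (c_inv : forall n x, invertible_in (@talg R N) (c n x))
    (c_GL2 : forall n x, in_GL2 (op_graph K (c n x)))
    (c_cocycle : forall n m : int, {ae mu, forall x,
       c (n + m) x = c n (iterz f g m x) \o c m x})
    (c_measurable : (forall n, sot_measurable (c n)) \/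
       (forall n, sot_measurable (fun x => lmul K (c n x))))
    (c_integrable :
       (\int[mu]_x norm2 (logop (absop (op_graph K (c 1%R x)))) < +oo)%E)
    (Lambda : X -> set (L2 K * L2 K))
    (Lambda_limit : {ae mu, forall x,
       [/\ in_GL2 (Lambda x), positive_op (Lambda x),
           in_L2 (logop (Lambda x)) &
           (fun n : nat => (n%:R : R[i])^-1 *:
              L2_vector (logop (absop (op_graph K (c n x))))) @ \oo
             --> L2_vector (logop (Lambda x))]}) :
  {ae mu, forall x,
     (fun n : nat => fk_det (absop (op_graph K (c n x))) `^ (n%:R^-1)) @ \oo
       --> fk_det (Lambda x)}.
Proof.
apply: filterS Lambda_limit => x [_ pL LL limL].
rewrite log_fk_det//; set u := L2_vector _ in limL *.
apply: (@cvg_trans _ ((fun n : nat => expR (ip ((n%:R : R[i])^-1 *: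
    L2_vector (logop (absop (op_graph K (c n x))))) (L2_of K idfun))) @ \oo)).
  apply: near_eq_cvg; near=> n.
  have [_ cL2] := c_GL2 n x.
  rewrite log_fk_det//; last exact: absop_positive_op.
  rewrite -expRM; congr expR.
  have -> : (n%:R : R[i])^-1 = (n%:R^-1)%:C by rewrite fmorphV rmorph_nat.
  by rewrite ipZl mulrC.
(* Norm convergence of the logarithms is tested against xi alone, then exponentiated. *)
have := ip_cvg (w := L2_of K idfun) limL.
exact: (continuous_cvg _ (@continuous_expR R _)).
Unshelve. all: by end_near. Qed.
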